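(* For every $n\ge1$, $$\sum_{\sigma\in S_n} q^{\,\mathrm{run}(\sigma)-1+2\,\mathrm{lsg}^*(\sigma)+\mathrm{rsg}^*(\sigma)+\nu(\sigma)}=[n]_q!.$$
   Context: $[n]_q=\frac{1-q^n}{1-q}$, $[n]_q!=[n]_q\cdots[1]_q$. A permutation $\sigma\in S_n$ is written as the word $\sigma(1)\cdots\sigma(n)$; its runs are the maximal contiguous increasing segments, $\mathrm{run}(\sigma)$ is their number. A run of length $\ge2$ is proper, of length 1 is a singleton run. Classes of elements: openers (first elements of proper runs), closers (last elements of proper runs), singletons (elements forming singleton runs), continuators (all other elements). Let $R_1$ denote the run containing the value $1$. For $i\in\{1,\dots,n\}$: if $i$ is a closer or singleton, $\mathrm{lsg}^*(i)$ is the number of runs other than $R_1$ lying strictly to the left of $i$ (not containing $i$) that contain both an element smaller and an element greater than $i$; if $i$ is an opener or continuator, $\mathrm{lsg}^*(i)$ is the number of runs lying strictly to the left of $i$ that either equal $R_1$ or contain both an element smaller and an element greater than $i$. $\mathrm{rsg}^*(i)$ is defined analogously with runs strictly to the right of $i$. Then $\mathrm{lsg}^*(\sigma)=\sum_i\mathrm{lsg}^*(i)$, $\mathrm{rsg}^*(\sigma)=\sum_i\mathrm{rsg}^*(i)$. The statistic $\nu(\sigma)$ (denoted $n(\sigma)$ in the paper): let $d$ be the largest element of $R_1$. Consider the subword $w$ of $\sigma$ consisting of the entries to the right of $d$. If no left-to-right minimum of $w$ forms a singleton run of $\sigma$, put $\nu(\sigma)=0$. Otherwise let $c$ be the rightmost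 left-to-right minimum of $w$ that forms a singleton run of $\sigma$, let $\mathrm{nleft}(\sigma)=\#\{i: i<\sigma^{-1}(1),\ c<\sigma(i)<d\}$, and put $\nu(\sigma)=2(d-c)-\mathrm{nleft}(\sigma)$. (Example: for $\sigma=7\,12\,|\,1\,6\,9\,|\,3\,|\,2\,10\,11\,|\,5\,|\,4\,8$ one has $d=9$, $c=3$, $\mathrm{nleft}=1$, $\nu(\sigma)=11$, $\mathrm{lsg}^*(\sigma)=10$, $\mathrm{rsg}^*(\sigma)=8$.) *)

(* Defs.v *)
From mathcomp Require Import all_boot all_order all_algebra all_fingroup.
Set Implicit Arguments. Unset Strict Implicit. Unset Printing Implicit Defensive.
Import GRing.Theory.

(* A permutation sigma in S_n is encoded by its word
   sigma(1) ... sigma(n), a seq nat with values 1..n.  Positions in the word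
   are 0-based (p < n).  All statistics are computed from the word. *)

Section Stats.
Variable w : seq nat.

Definition wlen := size w.
Definition wat (p : nat) : nat := nth 0 w p.

Definition run_start (p : nat) : bool := (p == 0) || (wat p < wat p.-1).

Definition nrun : nat := count run_start (iota 0 wlen).

Definition rid (p : nat) : nat := (count run_start (iota 0 p.+1)).-1.

Definition run_pos (r : nat) : seq nat := [seq p <- iota 0 wlen | rid p == r].
Definition run_vals (r : nat) : seq nat := [seq wat p | p <- run_pos r].
Definition run_len (r : nat) : nat := size (run_pos r).

Definition is_singleton (p : nat) : bool := run_len (rid p) == 1.
Definition is_run_end (p : nat) : bool := (p.+1 == wlen) || run_start p.+1.
Definition is_opener (p : nat) : bool := run_start p && (1 < run_len (rid p)).
Definition is_closer (p : nat) : bool := is_run_end p && (1 < run_len (rid p)).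
Definition is_continuator (p : nat) : bool :=
  [&& ~~ is_opener p, ~~ is_closer p & ~~ is_singleton p].

Definition pos1 : nat := index 1 w.
Definition r1 : nat := rid pos1.

Definition straddles (r v : nat) : bool :=
  has (fun x => x < v) (run_vals r) && has (fun x => v < x) (run_vals r).

Definition counts (p r : nat) : bool :=
  if is_closer p || is_singleton p then (r != r1) && straddles r (wat p)
  else (r == r1) || straddles r (wat p).

Definition lsg_at (p : nat) : nat := count (counts p) (iota 0 (rid p)).
Definition rsg_at (p : nat) : nat :=
  count (counts p) (iota (rid p).+1 (nrun - (rid p).+1)).

Definition lsg : nat := sumn [seq lsg_at p | p <- iota 0 wlen].
Definition rsg : nat := sumn [seq rsg_at p | p <- iota 0 wlen].

Definition dval : nat := foldr maxn 0 (run_vals r1).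
Definition dpos : nat := index dval w.
Definition right_pos : seq nat := iota dpos.+1 (wlen - dpos.+1).
Definition is_ltr_min_right (p : nat) : bool :=
  (dpos < p) && all (fun p' => wat p < wat p') (iota dpos.+1 (p - dpos.+1)).
Definition cand : seq nat :=
  [seq p <- right_pos | is_ltr_min_right p && is_singleton p].
Definition nu : nat :=
  if cand is _ :: _ then
    let c := wat (last 0 cand) in
    let nleft := count (fun x => (c < x) && (x < dval)) (take pos1 w) in
    2 * (dval - c) - nleft
  else 0.

Definition stat : nat := nrun.-1 + 2 * lsg + rsg + nu.
End Stats.

Definition perm_word n (s : 'S_n) : seq nat := [seq (s i).+1 | i <- enum 'I_n].

Definition qint (k : nat) : {poly int} := \sum_(j < k) 'X^j.
Definition qfact (n : nat) : {poly int} := \prod_(i < n) qint i.+1.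

(* Main.v *)
Require Import Defs.
From mathcomp Require Import all_boot all_order all_algebra all_fingroup.
From mathcomp Require Import ring zify.
Import GRing.Theory.
Set Implicit Arguments. Unset Strict Implicit. Unset Printing Implicit Defensive.

(* A permutation is built by inserting the values 1, ..., n in increasing order.
   After step i one sees the letters <= i, separated by gaps; every gap but the
   first is preceded by a run that is still open, and inserting i+1 into a gap
   makes it an opener, a closer, a continuator or a singleton.  The statistic
   splits into contributions of the letters, and the contribution of i+1 is
   read off the gap it enters, the position of the run of 1 and whether that run
   is still open.  Thus the total weight B of all completions, once the run of 1
   is closed, depends only on the number of remaining letters and on the numbers
   p and r of open runs to the left and to the right of the run of 1.

   The statistic nu adds, as long as the run of 1 is open and a singleton c has
   been inserted right after it, a weight q or q^2 to each letter.  This is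
   exactly the weight change, in the phase where the run of 1 is closed, caused
   by one more open run glued to the right of the run of 1; so the completions
   weigh q^2 B(p, r+1) in this phase (letters c < v <= d).  Consequently, if A is
   the total weight of the completions while the run of 1 is open and there is no
   c yet, the terms in A and B that depend on p cancel in A + B: it depends only
   on h = p + r and satisfies the recurrence of the q-Laguerre moments, solved by
   q^(h choose 2) [m]! binom(m+1, h+1)_q.  The letter 1 leaves its run
   open or closes it at once, so the sum in question is this expression at
   m = n - 1, h = 0. *)

(** * q-identities *)

Section QIdentities.
Local Open Scope ring_scope.
Variables (K : comNzRingType) (q : K).

Definition qi (k : nat) : K := \sum_(j < k) q ^+ j.
Definition qf (n : nat) : K := \prod_(i < n) qi i.+1.

Lemma qfS n : qf n.+1 = qf n * qi n.+1.
Proof. by rewrite /qf big_ord_recr. Qed.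

Lemma qi0 : qi 0 = 0. Proof. by rewrite /qi big_ord0. Qed.

Lemma qiD a b : qi (a + b) = qi a + q ^+ a * qi b.
Proof.
rewrite /qi big_split_ord /= mulr_sumr; congr (_ + _).
by apply: eq_bigr => i _; rewrite exprD.
Qed.

Lemma qi1 : qi 1 = 1. Proof. by rewrite /qi big_ord_recl big_ord0 expr0 addr0. Qed.

Lemma qiS k : qi k.+1 = 1 + q * qi k.
Proof. by rewrite -add1n qiD qi1 expr1. Qed.

Lemma sum_qpow a k : \sum_(j < k) q ^+ (a + j) = q ^+ a * qi k.
Proof. by rewrite /qi mulr_sumr; apply: eq_bigr => i _; rewrite exprD. Qed.

Fixpoint qbin (n k : nat) : K :=
  match n, k with
  | _, 0%N => 1
  | 0%N, _.+1 => 0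
  | n'.+1, k'.+1 => qbin n' k' + q ^+ k * qbin n' k
  end.

Lemma qbin0 n : qbin n 0 = 1. Proof. by case: n. Qed.
Lemma qbinS n k : qbin n.+1 k.+1 = qbin n k + q ^+ k.+1 * qbin n k.+1.
Proof. by []. Qed.

Lemma qbin_small n k : (n < k)%N -> qbin n k = 0.
Proof.
elim: n k => [|n IH] [|k] //= lt_nk.
by rewrite !IH ?mulr0 ?addr0 // ltnW.
Qed.

(** The inner identity [lhsE] is the companion rule [k+1] binom(n+1,k+1) = [n+1] binom(n,k). Both
    steps split [n+1] as [k+1] + q^(k+1) [n-k]; for k > n both sides vanish, so the truncated
    [n - k] is harmless. *)
Lemma qbin_absorb n k : qi k.+1 * qbin n k.+1 = qi (n - k) * qbin n k.
Proof.
elim: n k => [|n IH] k; first by rewrite sub0n qi0 mulr0 mul0r.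
have lhsE : qi k.+1 * qbin n.+1 k.+1 = qi n.+1 * qbin n k.
  rewrite qbinS mulrDr mulrCA IH.
  have [le_kn|lt_nk] := leqP k n; last by rewrite qbin_small // !mulr0 addr0.
  have -> : n.+1 = (k.+1 + (n - k))%N by rewrite addSn subnKC.
  by rewrite qiD; ring.
rewrite {}lhsE; case: k => [|k]; first by rewrite subn0 !qbin0.
rewrite subSS qbinS mulrDr -IH.
have [le_kn|lt_nk] := ltnP k.+1 n.+2; last first.
  by rewrite qbin_small ?(ltnW lt_nk) // !mulr0 addr0.
have -> : n.+1 = (k.+1 + (n - k))%N by rewrite addSn subnKC.
by rewrite qiD; ring.
Qed.

(* Total weight A + B of the completions: [m] letters remain and [h] runs other
   than the run of 1 are open. *)
Definition fsum (m h : nat) : K := q ^+ 'C(h, 2) * qf m * qbin m.+1 h.+1.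

Lemma fsum_last m : fsum m 0 = qf m.+1.
Proof.
rewrite /fsum /qf big_ord_recr /= mulrAC mulrC; congr (_ * _).
by have := qbin_absorb m.+1 0; rewrite subn0 qi1 qbin0 mulr1 mul1r.
Qed.

Lemma fsum0 h : fsum 0 h = (h == 0%N)%:R.
Proof.
case: h => [|h]; last by rewrite /fsum qbin_small ?mulr0.
by rewrite fsum_last /qf big_ord_recl big_ord0 qi1 mulr1.
Qed.

(** The three terms correspond to a new opener, to a singleton or continuator, and to a closer.
    Without the common factor q^binom(h,2) [m]! the recurrence is [keyE], which absorption reduces
    to two splittings of [m+1]. At h = 0 the truncated [h.-1] is multiplied by [0] = 0. *)
Lemma fsumS m h :
  fsum m.+1 h = q ^+ (h + 2) * qi h.+2 * fsum m h.+1
    + (1 + q) * q ^+ h * qi h.+1 * fsum m h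
    + q ^+ h.-1 * qi h * fsum m h.-1.
Proof.
have keyE : qi m.+1 * qbin m.+2 h.+1 =
    q ^+ (h + h + 2) * (qi h.+2 * qbin m.+1 h.+2)
    + (1 + q) * q ^+ h * (qi h.+1 * qbin m.+1 h.+1) + qi h * qbin m.+1 h.
  rewrite qbin_absorb subSS qbinS.
  case: (ltngtP h m.+1) => [lt_hm|lt_mh|->].
  - have abs : qi h.+1 * qbin m.+1 h.+1 = qi (m.+1 - h) * qbin m.+1 h.
      exact: qbin_absorb.
    have e1 : qi m.+1 = qi h + q ^+ h * qi (m.+1 - h).
      by rewrite -qiD subnKC // ltnW.
    have e2 : qi m.+1 = qi h.+1 + q ^+ h.+1 * qi (m - h).
      by rewrite -qiD addSn subnKC.
    rewrite mulrDr {1}e1 mulrDl -[q ^+ h * _ * _]mulrA -abs e2.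
    rewrite !exprD expr2 exprS; ring.
  - rewrite !(@qbin_small _ h) ?(@qbin_small _ h.+1) //; first by ring.
    by rewrite ltnW.
  - by rewrite !(@qbin_small _ m.+2) // !mulr0 !addr0 add0r.
have binE : 'C(h.+1, 2) = ('C(h, 2) + h)%N by rewrite binS bin1 addnC.
rewrite /fsum qfS.
transitivity (q ^+ 'C(h, 2) * qf m * (qi m.+1 * qbin m.+2 h.+1)).
  by rewrite !mulrA.
rewrite {}keyE {}binE.
case: h => [|h]; first by rewrite qi0 !exprD; ring.
have -> : 'C(h.+1, 2) = ('C(h, 2) + h)%N by rewrite binS bin1 addnC.
rewrite -[h.+1.-1]/h !exprD !exprS; ring.
Qed.

(** The first sum has the openers and singletons, which may enter any of the [p.+1] gaps left of 1;
    the second has the continuators and closers, which cannot enter the first gap. *)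
Definition lop (x : nat -> nat -> K) (p r : nat) : K :=
  \sum_(j < p.+1) (q ^+ (p + r + 2 + j) * x p.+1 r
                   + q ^+ (p + r + 1 + j) * x p r)
  + \sum_(j < p) (q ^+ (p + r + j) * x p r
                  + q ^+ ((p + r).-1 + j) * x p.-1 r).

Definition rop (x : nat -> nat -> K) (p r : nat) : K :=
  \sum_(j < r) (q ^+ (p + r + 4 + (p + j)) * x p r.+1
                + q ^+ (p + r + 2 + (p + j)) * x p r
                + q ^+ (p + r + 1 + (p + j)) * x p r
                + q ^+ ((p + r).-1 + (p + j)) * x p r.-1).

(* Weight of the completions by [m] letters once the run of 1 is closed; [lop] and
   [rop] collect the insertions to the left and to the right of that run. *)
Fixpoint bsum (m p r : nat) : K :=
  if m is m'.+1 then lop (bsum m') p r + rop (bsum m') p r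
  else ((p == 0%N) && (r == 0%N))%:R.

(** One more open run on the right costs each letter inserted on the left a factor q, which is the
    weight that [nu] gives such a letter. *)
Lemma lop_shift x p r : lop x p r.+1 = q * lop (fun p r => x p r.+1) p r.
Proof.
rewrite /lop mulrDr !mulr_sumr; congr (_ + _); apply: eq_bigr => j _.
  by rewrite !addnS !addSn !exprS; ring.
rewrite !addnS !addSn /= !exprS.
have -> : (p + r = (p + r).-1.+1)%N.
  by case: p j => [[]|] //.
rewrite -pred_Sn !exprD !exprS; ring.
Qed.

(** The four isolated terms are the summand j = 0, that is, the insertions into the gap nearest to
    the run of 1. They will be matched with the insertions into the gap of the open run of 1; for
    the other gaps the extra run costs q^2. *)
Lemma rop_shift x p r :
  rop x p r.+1 = q ^+ (p + r + 5 + p) * x p r.+2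
    + q ^+ (p + r + 3 + p) * x p r.+1 + q ^+ (p + r + 2 + p) * x p r.+1
    + q ^+ (p + r + p) * x p r + q ^+ 2 * rop (fun p r => x p r.+1) p r.
Proof.
rewrite /rop big_ord_recl mulr_sumr /= addn0; congr (_ + _).
  by rewrite [(p + r.+1)%N]addnS -pred_Sn !(exprD, exprS); ring.
apply: eq_bigr => j _; rewrite /bump /= add1n.
case: r j => [[]|r] // j.
have -> : (p + r.+2).-1 = (p + r.+1).-1.+1 by rewrite !addnS.
rewrite /= !(exprD, exprS); ring.
Qed.

(** The recurrence in h = p + r is distributed over the sides of the run of 1. The last two terms
    stand for an opener and a continuator put into the gap of that run, the insertions that keep it
    open and create no singleton. *)
Lemma fsum_rec m p r (f := fun p r => fsum m (p + r)) :
  fsum m.+1 (p + r) = lop f p r + rop f p r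
    + q ^+ (p + r + 3 + p) * f p r.+1 + q ^+ (p + r + p) * f p r.
Proof.
rewrite /lop /rop /f fsumS !big_split /= -!mulr_suml.
have sumE a : \sum_(j < r) q ^+ (a + (p + j)) = q ^+ a * (q ^+ p * qi r).
  rewrite mulrA -exprD -sum_qpow.
  by apply: eq_bigr => j _; rewrite addnA.
rewrite !sumE !sum_qpow addSn addnS.
have e0 : qi (p + r) = qi p + q ^+ p * qi r by rewrite qiD.
have e1 : qi (p + r).+1 = qi p + q ^+ p * (1 + q * qi r).
  by rewrite -addnS qiD qiS.
have e2 : qi (p + r).+2 = qi p.+1 + q ^+ p.+1 * (1 + q * qi r).
  by have -> : (p + r).+2 = (p.+1 + r.+1)%N; rewrite ?qiD ?[qi r.+1]qiS // addSn addnS.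
have eSp : qi p.+1 = qi p + q ^+ p by rewrite -addn1 qiD qi1 mulr1.
(* The two predecessors differ only for a = 0, where [0] = 0 kills both sides; so the closers on
   either side lead to the same value at [(p + r).-1]. *)
have pE a c : qi a * fsum m (a.-1 + c) = qi a * fsum m (a + c).-1.
  by case: a => [|a] //; rewrite qi0 !mul0r.
have rE a c : qi a * fsum m (c + a.-1) = qi a * fsum m (c + a).-1.
  by rewrite addnC pE addnC.
move: (pE p r) (rE r p).
rewrite e0 e1 e2 eSp [(p + r.+1)%N]addnS !(exprD, exprS).
move: (fsum m _) (fsum m _) (fsum m _) => F0 F1 F2 pH rH.
ring: pH rH.
Qed.

End QIdentities.

(** * Collapsing large letters to gaps *)

Section Collapse.
Variable N : nat.

(* The maximal blocks of letters > [i] of [s] become single gap letters [N], which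
   is meant to exceed all other letters; [a] is the letter preceding [s]. *)
Fixpoint coll (i a : nat) (s : seq nat) : seq nat :=
  if s is x :: s' then
    if i < x then if i < a then coll i x s' else N :: coll i x s'
    else x :: coll i x s'
  else [::].

Lemma coll_cat i a s1 s2 :
  coll i a (s1 ++ s2) = coll i a s1 ++ coll i (last a s1) s2.
Proof. by elim: s1 a => //= x s IH a; rewrite IH; do 2?case: ifP. Qed.

Lemma coll_ext i a b s : (i < a) = (i < b) -> coll i a s = coll i b s.
Proof. by case: s => //= x s ->. Qed.

Lemma coll_shift i a s : i.+1 != a -> i.+1 \notin s -> coll i.+1 a s = coll i a s.
Proof.
have ltE x : i.+1 != x -> (i.+1 < x) = (i < x) 
  by move=> nx; rewrite [RHS]leq_eqVlt (negPf nx).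
elim: s a => //= x s IH a na; rewrite inE negb_or => /andP[nx ns].
by rewrite !ltE // IH.
Qed.

Lemma size_coll i a s : size (coll i a s) <= size s.
Proof. by elim: s a => //= x s IH a; do 2?case: ifP => _ //=; rewrite ?ltnS ?leqW. Qed.

Lemma all_coll i a s : all (fun x => (x <= i) || (x == N)) (coll i a s).
Proof.
elim: s a => //= x s IH a; case: ifP => hx; last by rewrite /= IH leqNgt hx.
by case: ifP => //= _; rewrite eqxx orbT IH.
Qed.

Lemma mem_coll i a s x : x != N -> x <= i -> (x \in coll i a s) = (x \in s).
Proof.
move=> nx lx; elim: s a => //= y s IH a; case: ifP => hy; last by rewrite !inE IH.
have nxy : (x == y) = false by apply/eqP; lia.
by case: ifP => _; rewrite !inE IH nxy ?(negPf nx).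
Qed.

Lemma last_coll i a s : i < N -> (i < last a (coll i a s)) = (i < last a s).
Proof.
move=> ltN; suff: forall b, (i < a) = (i < b) ->
  (i < last b (coll i a s)) = (i < last a s) by apply.
elim: s a => [|x s IH] a b //= eab; case: ifP => hx; last exact: IH.
by case: ifP => ha; apply: IH => /=; rewrite hx -?eab ?ha ?ltN.
Qed.

Lemma head_coll i a s x : ~~ (i < a) -> i < N -> x <= i ->
  (head 0 (coll i a s) < x) = (head 0 s < x).
Proof.
move=> /negPf na ltN lx; case: s => //= y s; case: ifP => //= hy.
by rewrite na /=; apply/idP/idP; lia.
Qed.

(** A block of letters > [v] lies inside a block of letters > [i], and its gap letter [N] still
    exceeds [i]. The last hypothesis concerns a word that starts inside a block: what the inner
    collapse drops there, the outer one must drop too. *)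
Lemma coll_coll i v a b s : i <= v -> v < N -> (v < b -> i < a) ->
  coll i a (coll v b s) = coll i a s.
Proof.
move=> le_iv ltN; elim: s a b => //= x s IH a b hab.
have [lt_vx|le_xv] := ltnP v x.
  have lt_ix : i < x by apply: leq_ltn_trans lt_vx.
  rewrite lt_ix; case: ifP => hb.
    have ha := hab hb; rewrite ha IH //.
    by apply: coll_ext; rewrite ha lt_ix.
  have lt_iN : i < N by lia.
  by rewrite /= lt_iN; case: ifP => ha; rewrite IH //;
    rewrite (@coll_ext _ N x) // lt_iN lt_ix.
by rewrite /= !IH //; lia.
Qed.

Lemma coll_large i a s1 s2 : i < N -> s1 != [::] -> all (ltn i) s1 ->
  coll i a (s1 ++ s2) = nseq (~~ (i < a)) N ++ coll i N s2.
Proof.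
move=> ltN; elim: s1 a => //= x s1 IH a _ /andP[hx h1]; rewrite hx.
case: s1 h1 IH => [|y s1] h1 IH.
  by rewrite (@coll_ext _ x N) ?hx ?ltN //=; case: ifP.
by rewrite !IH // hx /=; case: ifP.
Qed.

Fixpoint splits (s : seq nat) : seq (seq nat * seq nat) :=
  if s is x :: s' then
    nseq (x == N) ([::], s') ++ [seq (x :: y.1, y.2) | y <- splits s']
  else [::].

Lemma mem_splits s y : (y \in splits s) = (s == y.1 ++ N :: y.2).
Proof.
case: y => y1 y2 /=; elim: s y1 => [|x s IH] [|z y1] //=.
  rewrite mem_cat mem_nseq /= lt0b eqseq_cons; case: eqP => //= ex.
    rewrite -pair_eqE /pair_eq /= eq_sym; case: eqP => //= _.
    by apply/mapP => -[].
  by apply/mapP => -[].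
rewrite mem_cat mem_nseq eqseq_cons -pair_eqE /pair_eq /= andbF /=.
rewrite -IH; apply/mapP/andP => [[[a b] h [-> -> ->]] //|[/eqP -> h]].
by exists (y1, y2).
Qed.

Lemma splits_cat s1 s2 :
  splits (s1 ++ s2) = [seq (y.1, y.2 ++ s2) | y <- splits s1]
                      ++ [seq (s1 ++ y.1, y.2) | y <- splits s2].
Proof.
elim: s1 => [|x s1 IH] /=; first by rewrite map_id_in // => -[].
by rewrite IH map_cat !map_cat -!map_comp map_nseq /= catA.
Qed.

Lemma uniq_splits s : uniq (splits s).
Proof.
elim: s => //= x s IH; rewrite cat_uniq map_inj_uniq ?IH ?andbT; last first.
  by move=> [a b] [c d] [-> ->].
case: (x == N) => //=; last by apply/hasPn => y.
by apply/hasPn => y /mapP[z _ ->]; rewrite inE.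
Qed.

(** A gap is identified by the number of gaps before it; this turns sums over gaps into the sums
    over [j] in [lop] and [rop]. *)
Lemma big_splits (K : nmodType) s (P : pred nat) (f : nat -> K) :
  (\sum_(y <- splits s | P (count_mem N y.1)) f (count_mem N y.1)
   = \sum_(j < count_mem N s | P j) f j)%R.
Proof.
elim: s P f => [|x s IH] P f /=; first by rewrite big_nil big_ord0.
rewrite big_cat big_map /=; case: eqP => /= _.
  rewrite (IH (P \o succn) (f \o succn)) big_mkcond /= big_seq1.
  by rewrite [RHS]big_mkcond big_ord_recl /= -big_mkcond.
by rewrite big_nil add0r (IH P f).
Qed.

(* Insertion of [v] into a gap; [t] tells on which sides of [v] a gap remains:
   (true, true) opener, (true, false) singleton, (false, true) continuator,
   (false, false) closer. *)
Definition ins (v : nat) (t : bool * bool) (y : seq nat * seq nat) : seq nat :=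
  (y.1 ++ nseq t.1 N) ++ v :: nseq t.2 N ++ y.2.

(* Only openers and singletons may enter the first gap, which has no run before it. *)
Definition gaps (t : bool * bool) (s : seq nat) :=
  [seq y <- splits s | t.1 || (0 < count_mem N y.1)].

Definition types := [:: (true, true); (true, false); (false, true); (false, false)].

Definition succ (v : nat) (s : seq nat) : seq (seq nat) :=
  [seq ins v t y | t <- types, y <- gaps t s].

Lemma split_inj (v : nat) s1 s2 t1 t2 : v \notin s1 -> v \notin t1 ->
  s1 ++ v :: s2 = t1 ++ v :: t2 -> s1 = t1 /\ s2 = t2.
Proof.
elim: s1 t1 => [|x s1 IH] [|y t1] //=.
- by move=> _ _ [].
- by move=> _; rewrite inE negb_or => /andP[/eqP ny _] [/ny].
- by rewrite inE negb_or => /andP[/eqP ny _] _ [] /esym/ny.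
rewrite !inE !negb_or => /andP[_ h1] /andP[_ h2] [-> e].
by have [-> ->] := IH _ h1 h2 e.
Qed.

(** Collapsing never lengthens a word, so if it fixes a concatenation it fixes both factors. Two
    adjacent gaps would merge and shorten the word. *)
Lemma splits_collapsed i s y : i < N -> coll i 0 s = s -> y \in splits s ->
  [/\ coll i 0 y.1 = y.1, last 0 y.1 <= i & coll i N y.2 = y.2].
Proof.
case: y => y1 y2 /= ltN cs; rewrite mem_splits /= => /eqP es.
move: cs; rewrite es coll_cat => /eqP.
have := size_coll i 0 y1; have := size_coll i (last 0 y1) (N :: y2).
move=> sz2 sz1 e; have := congr1 size (eqP e); rewrite !size_cat => sz.
have szE : size (coll i 0 y1) = size y1.
  by apply/eqP; rewrite eqn_leq sz1 -(leq_add2r (size (N :: y2))) -sz leq_add2l.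
move: e; rewrite eqseq_cat // => /andP[/eqP -> /eqP /=].
rewrite ltN; case: ifP => hl; last by move=> [->]; rewrite leqNgt hl.
by move=> /(congr1 size); have := size_coll i N y2; rewrite /=; lia.
Qed.

Lemma last_neqN i s y : i < N -> coll i 0 s = s -> y \in splits s ->
  forall z, y.1 != rcons z N.
Proof.
move=> ltN cs /(splits_collapsed ltN cs)[_ h _] z; apply/eqP => e.
by move: h; rewrite e last_rcons leqNgt ltN.
Qed.

Lemma head_neqN i s y : i < N -> coll i 0 s = s -> y \in splits s ->
  forall z, y.2 != N :: z.
Proof.
move=> ltN cs /(splits_collapsed ltN cs)[_ _ h] z; apply/eqP => e.
move: h; rewrite e /= ltN => /(congr1 size) /=.
by have := size_coll i N z; lia.
Qed.

(** As no two gaps of [s] are adjacent, a letter [N] next to [i.+1] can only come from the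
    insertion; the neighbours of [i.+1] thus reveal the type, and then the gap. *)
Lemma uniq_succ i s : i.+1 < N -> coll i 0 s = s -> uniq (succ i.+1 s).
Proof.
move=> ltN cs; have lt_iN : i < N by lia.
have vs : i.+1 \notin s.
  by apply/negP; rewrite -cs => /(allP (all_coll i 0 s)) /=; lia.
have vN : (i.+1 == N) = false by apply/eqP; lia.
apply: allpairs_uniq_dep => //; first by move=> t _; rewrite filter_uniq ?uniq_splits.
move=> p p' /allpairsPdep[t [y [_ hy ->]]] /allpairsPdep[t' [y' [_ hy' ->]]] /=.
move: hy hy'; rewrite !mem_filter => /andP[_ hy] /andP[_ hy'].
have nv z b : z \in splits s -> i.+1 \notin z.1 ++ nseq b N.
  rewrite mem_splits => /eqP e; apply: contra vs; rewrite e !mem_cat inE.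
  by case/orP => [->//|]; rewrite mem_nseq vN andbF.
case/split_inj; rewrite ?nv // => e1 e2.
have := (last_neqN lt_iN cs hy, last_neqN lt_iN cs hy').
have := (head_neqN lt_iN cs hy, head_neqN lt_iN cs hy').
case: t t' y y' {hy hy' nv} e1 e2 => [[] []] [[] []] [y1 y2] [y1' y2'] /=; rewrite ?cats0 => e1 e2 [h2 h2'] [h1 h1'];
 rewrite ?cats1 in e1; 
 try (by have := h1 y1'; rewrite e1 eqxx);
 try (by have := h1' y1; rewrite -e1 eqxx); try (by have := h2 y2'; rewrite e2 eqxx);
 try (by have := h2' y2; rewrite -e2 eqxx).
- by case: e2 (rcons_inj e1) => -> [->].
- by rewrite e2; case: (rcons_inj e1) => ->.
- by case: e2 e1 => -> ->.
by rewrite e1 e2.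
Qed.

(** Forwards, the inserted letter with its remaining gaps is one block of letters > [i] and
    collapses back to the gap it came from. Backwards, the type is read off the neighbours of [i.+1]
    in [w]. *)
Lemma mem_succ i s w : i.+1 < N -> coll i 0 s = s -> head 0 s = N ->
  head 0 w = N -> count_mem i.+1 w = 1 ->
  (coll i.+1 0 w \in succ i.+1 s) = (coll i 0 w == s).
Proof.
move=> ltN cs hs hw cw; have lt_iN : i < N by lia.
apply/idP/eqP.
  case/allpairsPdep => t [y [_ ]]; rewrite mem_filter => /andP[_ hy] e.
  rewrite -(@coll_coll i i.+1 0 0 w) // e /ins.
  have es : s = y.1 ++ [:: N] ++ y.2 by apply/eqP; rewrite -mem_splits.
  rewrite -cat_cons -catA (catA (nseq _ _)) coll_cat coll_large //.
  - by rewrite -[RHS]cs es coll_cat coll_large //= lt_iN.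
  - by case: t.1.
  by rewrite all_cat /= ltnS leqnn /=; case: t.1 t.2 => -[] /=; rewrite ?lt_iN.
move=> es.
have vw : i.+1 \in w by rewrite -has_pred1 has_count cw.
case/splitPr: vw hw cw es => X Y hw.
rewrite count_cat /= eqxx addnCA add1n => -[] /eqP.
rewrite addn_eq0 => /andP[cX cY].
have nX : i.+1 \notin X by rewrite -has_pred1 has_count (eqP cX).
have nY : i.+1 \notin Y by rewrite -has_pred1 has_count (eqP cY).
have {hw} : head 0 X = N by case: X hw {cX nX} => //=; lia.
case: (lastP X) nX => [|X' x]; first by move=> _ /= hN; exfalso; lia.
move eX : (rcons X' x) => X0 nX hX.
have lX : last 0 X0 != i.+1.
  by apply: contra nX => /eqP <-; rewrite -eX last_rcons mem_rcons inE eqxx.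
rewrite !coll_cat -(@coll_shift i 0 X0) //= ltnn ltnSn => es.
(* A gap remains on a side of [i.+1] exactly when its neighbour there is greater; the default 0 of
   [head] leaves no gap at the end of the word. *)
pose t := (i.+1 < last 0 X0, i.+1 < head 0 Y).
have ltl : (i < last 0 X0) = t.1.
  by rewrite /t /= [LHS]leq_eqVlt eq_sym (negPf lX).
have eY : coll i.+1 i.+1 Y = nseq t.2 N ++ coll i.+1 N Y.
  by rewrite /t; case: (Y) => //= y Y'; rewrite ltnn ltN; case: ifP.
have eYi : coll i i.+1 Y = coll i.+1 N Y.
  by rewrite coll_shift ?(@coll_ext i i.+1 N) ?ltnSn ?lt_iN //; apply/eqP; lia.
rewrite eYi ltl in es; rewrite eY.
have [A eA] : exists A, coll i.+1 0 X0 = A ++ nseq t.1 N.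
  rewrite /t /=; case hl: (i.+1 < last 0 X0); last by exists (coll i.+1 0 X0); rewrite cats0.
  have := last_coll 0 X0 ltN; rewrite hl; have := all_coll i.+1 0 X0.
  case/lastP: (coll _ _ _) => [|A z]; first by rewrite /=; lia.
  rewrite all_rcons last_rcons => /andP[hz _] lz; exists A.
  by rewrite cats1; congr rcons; apply/eqP; lia.
clearbody t; apply/allpairsPdep; exists t, (A, coll i.+1 N Y); split.
- by case: (t) => [[] []].
- rewrite mem_filter mem_splits -es eA /=; apply/andP; split.
    move: eA; case: t.1 => //=; rewrite cats0 => <-.
    rewrite -has_count has_pred1; case: (X0) hX => [|z Z] /=; first lia.
    by move=> ->; rewrite ltN /= inE eqxx.
  by case: t.1 => /=; rewrite -?catA ?cats0.
by rewrite /ins /= eA -catA.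
Qed.

Lemma succ_valid i s s' : i.+1 < N -> coll i 0 s = s -> head 0 s = N ->
  perm_eq [seq x <- s | x <= i] (iota 1 i) -> s' \in succ i.+1 s ->
  [/\ coll i.+1 0 s' = s', head 0 s' = N
    & perm_eq [seq x <- s' | x <= i.+1] (iota 1 i.+1)].
Proof.
move=> ltN cs hs ps; have lt_iN : i < N by lia.
have vs : i.+1 \notin s.
  by apply/negP; rewrite -cs => /(allP (all_coll i 0 s)) /=; lia.
case/allpairsPdep => t [[y1 y2] [_ ]]; rewrite mem_filter /= => /andP[ct hy] ->.
have [/= c1 l1 c2] := splits_collapsed lt_iN cs hy.
have /= n2 := head_neqN lt_iN cs hy.
move: hy; rewrite mem_splits => /eqP /= es.
have [v1 v2] : i.+1 \notin y1 /\ i.+1 \notin y2.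
  by apply/andP; move: vs; rewrite es mem_cat inE !negb_or => /and3P[-> _ ->].
have Nv : N != i.+1 by apply/eqP; lia.
split.
- have e1 : coll i.+1 0 y1 = y1 by rewrite coll_shift.
  have e2 : coll i.+1 N y2 = y2 by rewrite coll_shift // eq_sym.
  have e2' : coll i.+1 i.+1 y2 = y2.
    move: e2 n2; case: (y2) => //= z y2'; rewrite ltN ltnn; case: ifP => // hz.
    by move/(congr1 size) => /=; have := size_coll i.+1 z y2'; lia.
  have hl : (i.+1 < last 0 y1) = false by lia.
  by rewrite /ins -catA !coll_cat e1; case: t {ct} => -[] [] /=; rewrite ?hl ?ltN ?ltnn ?e2 ?e2' /= ?ltnn ?ltN ?e2.
- rewrite /ins -catA; move: hs; rewrite es.
  by case: (y1) ct => //=; rewrite orbF; case: t => -[].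
rewrite -[1 :: iota 2 i]/(iota 1 i.+1).
have -> : iota 1 i.+1 = rcons (iota 1 i) i.+1.
  by rewrite -[in LHS](addn1 i) iotaD cats1 add1n.
have nE b : [seq x <- nseq b N | x <= i.+1] = [::].
  by elim: b => //= b ->; rewrite leqNgt ltN.
rewrite /ins !filter_cat /= leqnn filter_cat !nE cats0 /=.
rewrite perm_catC /= perm_sym perm_rcons perm_cons perm_sym perm_catC.
apply: perm_trans ps; rewrite es filter_cat /= leqNgt lt_iN /=.
have fE s0 : i.+1 \notin s0 -> [seq x <- s0 | x <= i.+1] = [seq x <- s0 | x <= i].
  by move=> n0; apply: eq_in_filter => x hx; rewrite leq_eqVlt ltnS; case: eqP hx n0 => // -> ->.
by rewrite !fE.
Qed.

End Collapse.

(** * Letter weights *)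

Definition before (u : nat) (s : seq nat) := take (index u s) s.
Definition after (u : nat) (s : seq nat) := drop (index u s).+1 s.

Lemma before_cat u s1 s2 : u \notin s1 -> before u (s1 ++ u :: s2) = s1.
Proof.
by move=> nu; rewrite /before index_cat (negPf nu) /= eqxx addn0 take_size_cat.
Qed.

Lemma after_cat u s1 s2 : u \notin s1 -> after u (s1 ++ u :: s2) = s2.
Proof.
move=> nu; rewrite /after index_cat (negPf nu) /= eqxx addn0.
by rewrite -cat_rcons drop_size_cat // size_rcons.
Qed.

Lemma before_after u s : u \in s -> s = before u s ++ u :: after u s.
Proof. by move=> us; rewrite -[LHS](cat_take_drop (index u s)) drop_index. Qed.

Lemma notin_before u s : u \notin before u s.
Proof. by rewrite in_take_leq ?ltnn // index_size. Qed.

(* An increasing run not containing [v] has letters on both sides of [v] iff it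
   has exactly one adjacent pair [a < v < b]. *)
Fixpoint crossings (v a : nat) (s : seq nat) : nat :=
  if s is x :: s' then ((a < v) && (v < x)) + crossings v x s' else 0.

Fixpoint inc_prefix (a : nat) (s : seq nat) : seq nat :=
  if s is x :: s' then if a < x then x :: inc_prefix x s' else [::] else [::].

Fixpoint inc_rest (a : nat) (s : seq nat) : seq nat :=
  if s is x :: s' then if a < x then inc_rest x s' else s else [::].

(* Some left-to-right minimum [c < v] of [s], relative to the bound [m], is
   followed by a smaller letter (or by nothing), i.e. is a singleton run. *)
Fixpoint has_low (v m : nat) (s : seq nat) : bool :=
  if s is x :: s' then
    if x < v then (x < m) && (head 0 s' < x) || has_low v (minn x m) s'
    else has_low v m s'
  else false.

(* [lf]: 1 precedes the letter; [own]: it belongs to the run of 1; [op]: the run of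
   1 has a greater letter; [cc]: the letter contributes to [nu]; [lx], [rx]:
   numbers of crossings to its left and right. *)
Definition wgt (one start fin lf own op cc : bool) (lx rx : nat) : nat :=
  (start && ~~ one)
  + 2 * (if fin then lx - [&& lf, ~~ own & op] else lx + [&& lf, ~~ own & ~~ op])
  + (if fin then rx - [&& ~~ lf, ~~ own & op]
     else rx + [&& ~~ lf, ~~ own & ~~ op])
  + (if cc then 2 - ~~ lf else 0).

Section Weight.
Variable N : nat.

(** Meant for words with a leading [N]: it makes the first genuine letter a run start, while the
    default 0 of [head] makes the last letter a run end. Crossings are counted starting from [v]
    itself, so neither the leading [N] nor an ascent out of [v] counts. *)
Definition wt (v : nat) (s : seq nat) : nat :=
  let R := inc_prefix 1 (after 1 s) in
  wgt (v == 1) (v < last 0 (before v s)) (head 0 (after v s) < v)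
    (1 \in before v s) ((v == 1) || (v \in R)) (v < last 1 R)
    ((v <= last 1 R) && has_low v N (inc_rest 1 (after 1 s)))
    (crossings v v (before v s)) (crossings v v (after v s)).

Lemma before_coll v u s : u \in s -> u != N -> u <= v ->
  before u (coll N v 0 s) = coll N v 0 (before u s).
Proof.
move=> us uN uv; rewrite {1}(before_after us) coll_cat /= ltnNge uv /=.
by rewrite before_cat // mem_coll // notin_before.
Qed.

Lemma after_coll v u s : u \in s -> u != N -> u <= v ->
  after u (coll N v 0 s) = coll N v u (after u s).
Proof.
move=> us uN uv; rewrite {1}(before_after us) coll_cat /= ltnNge uv /=.
by rewrite after_cat // mem_coll // notin_before.
Qed.

Lemma crossings_ext v a b s : (a < v) = (b < v) -> crossings v a s = crossings v b s.
Proof. by case: s => //= x s ->. Qed.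

Lemma crossings_cat v a s1 s2 :
  crossings v a (s1 ++ s2) = crossings v a s1 + crossings v (last a s1) s2.
Proof. by elim: s1 a => //= x s1 IH a; rewrite IH addnA. Qed.

Lemma crossings_coll v a b s : v < N -> (v < b -> v <= a) ->
  crossings v a (coll N v b s) = crossings v a s.
Proof.
move=> ltN; elim: s a b => //= x s IH a b hab; case: ifP => hx; last first.
  by rewrite /= hx IH //; apply: ltnW.
case: ifP => hb.
  rewrite IH; last by move=> _; apply: hab.
  by rewrite ltnNge hab //= add0n; apply: crossings_ext; have := hab hb; lia.
rewrite /= ltN IH; last by move=> _; apply: ltnW.
by congr (_ + _); apply: crossings_ext; lia.
Qed.

(** In a collapsed word each gap is preceded by a letter <= [i], so entering it is one crossing of
    [i.+1], and there are no others. *)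
Lemma crossings_count i a s : i.+1 < N ->
  crossings i.+1 a (coll N i a s) = count_mem N (coll N i a s).
Proof.
move=> ltN; elim: s a => //= x s IH a; case: ifP => hx; last first.
  by rewrite /= IH; congr (_ + _); apply/eqP; case: eqP; lia.
case: ifP => ha.
  by rewrite -IH; apply: crossings_ext; lia.
by rewrite /= ltN eqxx -IH; congr (_ + _); [lia | apply: crossings_ext; lia].
Qed.

Lemma inc_cat a s1 s2 : path ltn a s1 -> head 0 s2 <= last a s1 ->
  inc_prefix a (s1 ++ s2) = s1 /\ inc_rest a (s1 ++ s2) = s2.
Proof.
elim: s1 a => [|x s1 IH] a /=; last by move=> /andP[-> hp] /(IH _ hp)[-> ->].
by move=> _; case: s2 => //= y s2; rewrite ltnNge => ->.
Qed.

Lemma inc_prefix_coll v a x s : v < N -> a <= v -> x <= v ->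
  (x \in inc_prefix a (coll N v a s)) = (x \in inc_prefix a s).
Proof.
move=> ltN; elim: s a => //= y s IH a av xv; rewrite (ltnNge v a) av /=.
have [hy|hy] := ltnP v y; last by rewrite /=; case: ifP => //= hay; rewrite !inE IH.
rewrite /=; have -> : a < y by lia. have -> /= : a < N by lia.
have big b t : v < b -> x \notin inc_prefix b t.
  elim: t b => //= z t IHt b hb; case: ifP => // hz.
  by rewrite inE negb_or IHt ?andbT; [apply/eqP|]; lia.
by rewrite !inE !(negPf (big _ _ _)) //; apply/idP/idP; lia.
Qed.

Lemma last_inc_coll v a s : v < N -> a <= v ->
  (v < last a (inc_prefix a (coll N v a s))) = (v < last a (inc_prefix a s)) /\
  (v <= last a (inc_prefix a (coll N v a s))) = (v <= last a (inc_prefix a s)).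
Proof.
move=> ltN; elim: s a => //= y s IH a av; rewrite (ltnNge v a) av /=.
have [hy|hy] := ltnP v y; last by rewrite /=; case: ifP => //= hay; apply: IH.
rewrite /=; have -> : a < y by lia. have -> /= : a < N by lia.
have big b t : b <= last b (inc_prefix b t).
  elim: t b => //= z t IHt b; case: ifP => //= hz.
  exact: leq_trans (ltnW hz) (IHt z).
have := big N (coll N v y s); have := big y s; rewrite /=.
by move=> h1 h2; split; apply/idP/idP; lia.
Qed.

Lemma has_low_coll v u m a s : v < N -> u <= v.+1 -> 
  has_low u m (coll N v a s) = has_low u m s.
Proof.
move=> ltN uv; elim: s a m => //= x s IH a m; case: ifP => hx.
  have -> : x < u = false by lia.
  have nu : N < u = false by lia.
  by case: ifP => _ /=; rewrite ?nu IH.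
rewrite /= !IH; case: ifP => // xu; rewrite head_coll // ?hx //.
by rewrite leqNgt hx.
Qed.

Lemma has_low_rest_coll v m a s : v < N -> a <= v ->
  has_low v m (inc_rest a (coll N v a s)) = has_low v m (inc_rest a s).
Proof.
move=> ltN; elim: s a => //= y s IH a av; rewrite (ltnNge v a) av /=.
have [hy|hy] := ltnP v y; last first.
  rewrite /=; case: ifP => //= hay; first exact: IH.
  by rewrite !has_low_coll // head_coll // -leqNgt.
rewrite /=; have -> : a < y by lia. have -> /= : a < N by lia.
have big b t : v <= b -> has_low v m (inc_rest b t) = has_low v m t.
  elim: t b => //= z t IHt b hb; case: ifP => // hz.
  by rewrite IHt ?ifF //; lia.
by rewrite !big ?has_low_coll // ltnW.
Qed.

(** Letters greater than [v] matter only through the gaps they form. Hence the contribution of [v]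
    is settled when [v] is inserted and factors out of the sum over completions. *)
Lemma wt_coll v s : 0 < v < N -> 1 \in s -> v \in s ->
  wt v (coll N v 0 s) = wt v s.
Proof.
case/andP => v0 ltN s1 sv.
have [vN oneN] : v != N /\ 1 != N by split; apply/eqP; lia.
rewrite /wt !before_coll ?after_coll //.
have [e1 e2] := last_inc_coll (after 1 s) ltN v0.
rewrite last_coll // head_coll ?ltnn // mem_coll // inc_prefix_coll //.
rewrite e1 e2 has_low_rest_coll // !crossings_coll //; by rewrite ?ltnn.
Qed.

(** On the left, the leading gap gives no crossing, whereas a gap remaining just before [v] gives
    one; these two effects cancel for openers and singletons and leave the correction [~~ t.1]
    otherwise. *)
Lemma wt_ins i s t (y : seq nat * seq nat) (v := i.+1) : v < N -> coll N i 0 s = s -> head 0 s = N ->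
  y \in gaps N t s ->
  let Z := after 1 (ins N v t y) in let R := inc_prefix 1 Z in
  wt v (ins N v t y) =
    wgt (v == 1) t.1 (~~ t.2) (1 \in y.1) ((v == 1) || (v \in R)) (v < last 1 R)
      ((v <= last 1 R) && has_low v N (inc_rest 1 Z))
      (count_mem N y.1 - ~~ t.1) (count_mem N y.2).
Proof.
move=> ltN cs hs; rewrite mem_filter => /andP[ht hy].
have lt_iN : i < N by exact: ltnW.
have ltvN : i.+1 < N by [].
have [c1 l1 c2] := splits_collapsed lt_iN cs hy.
have n2 := head_neqN lt_iN cs hy.
have vs : v \notin s.
  by apply/negP; rewrite -cs => /(allP (all_coll N i 0 s)) /=; rewrite /v; lia.
have vN : (v == N) = false by apply/eqP; lia.
have es : s = y.1 ++ N :: y.2 by apply/eqP; rewrite -mem_splits.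
have v1 : v \notin y.1 ++ nseq t.1 N.
  rewrite mem_cat mem_nseq vN andbF orbF; apply: contra vs.
  by rewrite es mem_cat => ->.
have h2 : head 0 y.2 <= i.
  case: (y.2) c2 n2 => //= x z; rewrite lt_iN; case: ltnP => // _.
  by move/(congr1 size) => /=; have := size_coll N i x z; lia.
have y1E : y.1 != [::] -> y.1 = N :: behead y.1.
  by move: hs; rewrite es; case: (y.1) => //= a b ->.
rewrite /wt /=; move: (after 1 (ins N v t y)) => Z.
rewrite /ins before_cat // !after_cat //.
have -> : (v < last 0 (y.1 ++ nseq t.1 N)) = t.1.
  by rewrite last_cat; case: t.1 => //=; rewrite ltnNge ltnW.
have -> : (head 0 (nseq t.2 N ++ y.2) < v) = ~~ t.2.
  by case: t.2 => //=; rewrite ltnNge ltnW.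
have -> : (1 \in y.1 ++ nseq t.1 N) = (1 \in y.1).
  by rewrite mem_cat mem_nseq (ltn_eqF (leq_ltn_trans _ ltN)) // andbF orbF.
have e2 : crossings v v y.2 = count_mem N y.2.
  by rewrite -[in RHS]c2 -crossings_count // c2; apply: crossings_ext; lia.
have -> : crossings v v (nseq t.2 N ++ y.2) = count_mem N y.2.
  rewrite -e2; case: t.2 => //=; rewrite ltnn /=.
  by apply: crossings_ext; lia.
suff -> : crossings v v (y.1 ++ nseq t.1 N) = count_mem N y.1 - ~~ t.1 by [].
rewrite crossings_cat.
have [y0|/y1E ey] := eqVneq y.1 [::].
  by rewrite y0 /=; case: t.1 => //=; rewrite ltnn.
have cE : crossings v v y.1 = (count_mem N y.1).-1.
  move: c1; rewrite ey /= lt_iN ltnn eqxx /= => -[c1].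
  rewrite add0n -[in RHS]c1 -crossings_count // c1; exact: crossings_ext.
have c0 : 0 < count_mem N y.1 by rewrite ey /= eqxx.
rewrite cE; have : last v y.1 <= i by move: l1; rewrite ey.
move=> lv; case: t.1 => /=; last by rewrite subn1 addn0.
by rewrite ltvN ltnS lv addn0 subn0 addn1 prednK.
Qed.

End Weight.

(** * Summing over fibers *)

Lemma has_low_ins N u v m t y1 y2 : u <= v -> v < N ->
  has_low u m (ins N v t (y1, y2)) = has_low u m (y1 ++ N :: y2).
Proof.
move=> uv ltN; have [vu Nu] : v < u = false /\ N < u = false by split; lia.
rewrite /ins /= -catA; elim: y1 m => [|x y1 IH] m /=.
  by case: t => -[] [] /=; rewrite ?vu ?Nu.
rewrite !IH; case: ifP => // xu; congr (_ && _ || _).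
by case: (y1) => //=; case: (t) => -[] [] /=; apply/idP/idP; lia.
Qed.

Lemma has_lowS v m m' s : v \notin s -> (forall x, x < v -> (x < m) = (x < m')) ->
  has_low v.+1 m s = has_low v m' s.
Proof.
elim: s m m' => //= x s IH m m'; rewrite inE negb_or => /andP[nx ns] hm.
rewrite ltnS leq_eqVlt eq_sym (negPf nx) /=; case: ifP => xv; last exact: IH.
by rewrite hm // (IH _ (minn x m')) // => z hz; rewrite !leq_min hm.
Qed.

(** The last hypothesis supplies a smaller bound or an earlier smaller letter, so the inserted [v]
    is no left-to-right minimum and cannot become a new [c]. *)
Lemma has_lowS_ins N v m t y1 y2 : v < N -> v \notin y1 -> v \notin y2 ->
  (m <= v) || has (gtn v) y1 ->
  has_low v.+1 m (ins N v t (y1, y2)) = has_low v m (y1 ++ N :: y2).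
Proof.
move=> ltN n1 n2; rewrite /ins /= -catA; elim: y1 m n1 => [|x y1 IH] m /= n1.
  rewrite orbF => mv; have -> : N < v = false by lia.
  have NS : N < v.+1 = false by lia.
  have vm : v < m = false by lia.
  have mE : minn v m = m by lia.
  by case: t => -[] [] /=; rewrite ?NS ltnSn vm /= mE ?NS (@has_lowS _ _ m).
move: n1; rewrite inE negb_or => /andP[nx n1].
have -> : (x < v.+1) = (x < v) by rewrite ltnS leq_eqVlt eq_sym (negPf nx).
case: ifP => xv hm; last first.
  by apply: IH.
rewrite IH // ?geq_min ?(ltnW xv) //; congr (_ && _ || _).
by case: (y1) => //=; case: (t) => -[] [] /=; apply/idP/idP; lia.
Qed.

(** Exponent for a letter of type [t] put left of 1 into a gap with [j] gaps before it, [h] being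
    the number of open runs besides that of 1; [j.-1] reflects that the first gap is forbidden. *)
Definition expL (t : bool * bool) (h j : nat) : nat :=
  match t with
  | (true, true) => h + 2 + j
  | (true, false) => h + 1 + j
  | (false, true) => h + j.-1
  | (false, false) => h.-1 + j.-1
  end.

Definition expR (t : bool * bool) (h j : nat) : nat :=
  match t with
  | (true, true) => h + 4 + j
  | (true, false) => h + 2 + j
  | (false, true) => h + 1 + j
  | (false, false) => h.-1 + j
  end.

(** The right side depends on [op] no more: an open run of 1 adds one crossing, which the starred
    statistic discounts for closers and singletons, while for openers and continuators it counts the
    run of 1 even when closed. *)
Lemma wgt_left op cc t h j : j <= h -> t.1 || (0 < j) ->
  wgt false t.1 (~~ t.2) false false op cc (j - ~~ t.1) (h + op - j)
  = expL t h j + cc.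
Proof.
move=> jh; case: t => -[] [] /= hj; rewrite /wgt /= ?subn0 ?muln1;
 case: op; case: cc => /=; lia.
Qed.

Lemma wgt_right op cc t p r j : j < r ->
  wgt false t.1 (~~ t.2) true false op cc (p + 1 + op + j - ~~ t.1) (r - 1 - j)
  = expR t (p + r) (p + j) + 2 * cc.
Proof.
move=> jr; case: t => -[] [] /=; rewrite /wgt /= ?subn0 ?muln1;
 case: op; case: cc => /=; lia.
Qed.

Lemma count_ins N v t y : v != N ->
  count_mem N (ins N v t y) = count_mem N y.1 + t.1 + t.2 + count_mem N y.2.
Proof.
move=> vN; rewrite /ins !count_cat /= !count_cat !count_nseq /= eqxx !mul1n.
by rewrite (negPf vN); lia.
Qed.

Section Sums.
Local Open Scope ring_scope.
Variables (K : comNzRingType) (q : K) (N : nat).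
Variables (x : nat -> nat -> K) (p r : nat).

Definition argL (t : bool * bool) :=
  match t with
  | (true, true) => x p.+1 r
  | (false, false) => x p.-1 r
  | _ => x p r
  end.

Definition argR (t : bool * bool) :=
  match t with
  | (true, true) => x p r.+1
  | (false, false) => x p r.-1
  | _ => x p r
  end.

Lemma sum_left c G L : count_mem N L = p.+1 ->
  (forall t y, y \in gaps N t L ->
     G t y = c * (q ^+ expL t (p + r) (count_mem N y.1) * argL t)) ->
  \sum_(t <- types) \sum_(y <- gaps N t L) G t y = c * lop q x p r.
Proof.
move=> cL GE.
have sumE t : \sum_(y <- gaps N t L) G t y =
    c * \sum_(j < p.+1 | t.1 || (0 < j)%N) (q ^+ expL t (p + r) j * argL t).
  rewrite (eq_big_seq _ (GE t)) -mulr_sumr big_filter -cL.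
  by rewrite (@big_splits N _ L (fun j => t.1 || (0 < j)%N)
                (fun j => q ^+ expL t (p + r) j * argL t)).
rewrite (eq_bigr _ (fun t _ => sumE t)) -mulr_sumr; congr (_ * _).
rewrite /types !big_cons big_nil /= addr0 addrA /lop -big_split; congr (_ + _).
(* For continuators and closers the index 0 drops out and the others shift by one, leaving [p]
   summands. *)
rewrite !(big_mkcond (fun j : 'I_p.+1 => (0 < j)%N)) /= !big_ord_recl /= !add0r.
by rewrite -big_split.
Qed.

Lemma sum_right c G T : count_mem N T = r ->
  (forall t y, y \in splits N T ->
     G t y = c * (q ^+ expR t (p + r) (p + count_mem N y.1) * argR t)) ->
  \sum_(t <- types) \sum_(y <- splits N T) G t y = c * rop q x p r.
Proof.
move=> cT GE.
have sumE t : \sum_(y <- splits N T) G t y =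
    c * \sum_(j < r) (q ^+ expR t (p + r) (p + j) * argR t).
  rewrite (eq_big_seq _ (GE t)) -mulr_sumr -cT.
  by rewrite (@big_splits N _ T xpredT
                (fun j => q ^+ expR t (p + count_mem N T) (p + j) * argR t)).
rewrite (eq_bigr _ (fun t _ => sumE t)) -mulr_sumr; congr (_ * _).
rewrite /types !big_cons big_nil /= addr0 /rop !addrA -!big_split.
by apply: eq_bigr.
Qed.

End Sums.

Section Fibers.
Variables (K : comNzRingType) (q : K) (n : nat).
Let N := n.+1.

Definition words := permutations (iota 1 n).
Definition tailwt i w := \sum_(i.+1 <= v < n.+1) wt N v (N :: w).
Definition fiber i s : K :=
  (\sum_(w <- words | coll N i 0 (N :: w) == s) q ^+ tailwt i w)%R.

Definition valid i s :=
  [/\ coll N i 0 s = s, head 0 s = N & perm_eq [seq x <- s | x <= i] (iota 1 i)].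

Lemma mem_words w : (w \in words) = perm_eq w (iota 1 n).
Proof. by rewrite mem_permutations. Qed.

(** The words over [s] are partitioned by their collapse at [i.+1], which ranges over [succ] without
    repetition; on each class the weight of [i.+1] is constant by [wt_coll]. *)
Lemma fiber_rec i s : i < n -> valid i s ->
  (fiber i s = \sum_(s' <- succ N i.+1 s) q ^+ wt N i.+1 s' * fiber i.+1 s')%R.
Proof.
move=> lt_in [cs hs _]; have ltN : i.+1 < N by [].
have termE s' : (q ^+ wt N i.+1 s' * fiber i.+1 s' =
    \sum_(w <- words | coll N i.+1 0 (N :: w) == s') q ^+ tailwt i w)%R.
  rewrite /fiber big_distrr big_seq_cond [RHS]big_seq_cond.
  apply: eq_bigr => w; rewrite mem_words => /andP[pw /eqP <-].
  have inw u : 0 < u <= n -> u \in N :: w.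
    by move=> hu; rewrite inE (perm_mem pw) mem_iota add1n ltnS hu orbT.
  have n0 : 0 < n by apply: leq_ltn_trans lt_in.
  rewrite wt_coll ?inw ?n0 //.
  transitivity (q ^+ (wt N i.+1 (N :: w) + tailwt i.+1 w))%R; first by rewrite exprD.
  by rewrite /tailwt [in RHS]big_ltn.
rewrite (eq_bigr _ (fun s' _ => termE s')).
rewrite (exchange_big_dep xpredT) // /fiber big_mkcond big_seq [RHS]big_seq.
apply: eq_bigr => w; rewrite mem_words => pw; rewrite -mem_succ //; last first.
  transitivity (count_mem i.+1 w); first by rewrite /= (gtn_eqF ltN).
  rewrite (seq.permP pw) count_uniq_mem ?iota_uniq // mem_iota add1n.
  by rewrite !ltnS lt_in.
set c := coll N i.+1 0 (N :: w).
rewrite -big_filter; case: ifP => hw.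
  rewrite (eq_filter (a2 := pred1 c)); last by move=> z /=; rewrite eq_sym.
  by rewrite filter_pred1_uniq ?uniq_succ // big_seq1.
rewrite (eq_in_filter (a2 := pred0)) ?filter_pred0 ?big_nil // => z hz /=.
by apply: contraFF hw => /eqP ->.
Qed.

(** With all letters placed, only the leading gap may remain, and then [s] is itself the one word in
    its fiber; any other gap, that is, a run still open, leaves the fiber empty. *)
Lemma fiber_last s : valid n s -> fiber n s = ((count_mem N s == 1)%:R)%R.
Proof.
move=> [cs hs ps].
have collE w : all (fun x => x <= n) w -> coll N n 0 (N :: w) = N :: w.
  move=> hw; rewrite /= ltnSn; congr cons.
  elim: w {2}N hw => //= x w IH a /andP[xn hw]; by rewrite ltnNge xn /= IH.
have wle w : w \in words -> all (fun x => x <= n) w.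
  rewrite mem_words => pw; rewrite (perm_all _ pw); apply/allP => x.
  by rewrite mem_iota; lia.
have Nw w : w \in words -> count_mem N w = 0.
  move/wle => hw; apply/eqP; rewrite -leqn0 leqNgt -has_count has_pred1.
  by apply/negP => /(allP hw); rewrite ltnn.
have -> : fiber n s = (\sum_(w <- words | N :: w == s) 1)%R.
  rewrite /fiber big_seq_cond [RHS]big_seq_cond; apply: eq_big => w.
    by case hw: (w \in words); rewrite // collE ?wle.
  by rewrite /tailwt big_geq.
case: s cs hs ps => [|x w] //= cs hs ps.
subst x; rewrite eqxx add1n eqSS.
rewrite (eq_bigl (pred1 w)); last by move=> z; rewrite eqseq_cons eqxx.
rewrite big_const_seq iter_addr_0 count_uniq_mem ?permutations_uniq //; congr (_%:R)%R.
congr nat_of_bool; apply/idP/eqP => [/Nw //|w0].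
have hw : all (fun x => x <= n) w.
  apply/allP => z hz; have := allP (all_coll N n 0 (N :: w)) z.
  rewrite /= cs inE hz orbT => /(_ isT) /orP[//|/eqP zN].
  by move: w0 hz => /eqP; rewrite -leqn0 leqNgt -has_count has_pred1 zN => /negPf ->.
move: ps; rewrite /= ltnn; have /all_filterP -> := hw => ps.
by rewrite mem_words.
Qed.

Lemma gaps_cat t L Z : head 0 L = N -> 0 < n ->
  gaps N t (L ++ 1 :: Z) =
    [seq (y.1, y.2 ++ 1 :: Z) | y <- gaps N t L]
    ++ [seq (L ++ 1 :: y.1, y.2) | y <- splits N Z].
Proof.
move=> hL n0; rewrite /gaps splits_cat filter_cat /=.
have -> /= : (1 == N) = false by rewrite /N; lia.
rewrite -map_comp !filter_map; congr (_ ++ _); congr map.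
(* The leading gap lies in [L], so every gap of [Z] admits all four types. *)
apply/all_filterP/allP => y _ /=; rewrite count_cat addn_gt0.
by case: L hL => //= a L ->; rewrite eqxx orbT.
Qed.

Lemma fiber_expand i L Z (v := i.+1) (s := L ++ 1 :: Z)
    (G := (fun s' => q ^+ wt N v s' * fiber v s')%R) :
  i < n -> valid i s -> head 0 L = N ->
  (fiber i s =
    \sum_(t <- types) \sum_(y <- gaps N t L) G (ins N v t (y.1, y.2 ++ 1 :: Z))
    + \sum_(t <- types) \sum_(y <- splits N Z)
        G (ins N v t (L ++ 1 :: y.1, y.2)))%R.
Proof.
move=> lt_in vs hL; rewrite fiber_rec // /succ big_allpairs_dep -big_split /=.
apply: eq_bigr => t _; rewrite gaps_cat //; last by apply: leq_ltn_trans lt_in.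
by rewrite big_cat !big_map.
Qed.

End Fibers.

(** * The two phases of the run of 1 *)

Lemma mem_inc_prefix x a s : x \in inc_prefix a s -> x \in s.
Proof.
elim: s a => //= y s IH a; case: ifP => // _; rewrite !inE.
by case: (x == y) => //= /IH.
Qed.

Lemma path_ltn_last a s x : path ltn a s -> x \in a :: s -> x <= last a s.
Proof.
elim: s a x => [|y s IH] a x /=; first by rewrite inE => _ /eqP ->.
case/andP => ay hp; rewrite inE => /orP[/eqP ->|hx]; last exact: IH.
exact: leq_trans (ltnW ay) (IH _ _ hp (mem_head y s)).
Qed.

Section Phases.
Variables (K : comNzRingType) (q : K) (n : nat).
Notation N := n.+1.
Local Notation fib := (fiber q n).

Lemma notin_valid i s : i < n -> valid n i s -> i.+1 \notin s.
Proof.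
move=> lt_in [<- _ _]; apply/negP => /(allP (all_coll _ _ _ _)) /=.
by rewrite ltnn /= eqSS => /eqP; lia.
Qed.

Lemma valid_ins i s t y : i < n -> valid n i s -> y \in gaps N t s ->
  valid n i.+1 (ins N i.+1 t y).
Proof.
move=> lt_in [cs hs ps] hy.
have [] := @succ_valid N i s (ins N i.+1 t y) lt_in cs hs ps; last by [].
by apply/allpairsPdep; exists t, y; split=> //; case: (t) => -[] [].
Qed.

Lemma ins_head t L y v : head 0 L = N -> y \in gaps N t L ->
  head 0 (ins N v t y) = N.
Proof.
case: y => y1 y2 hL; rewrite mem_filter mem_splits /= => /andP[ht /eqP eL].
by move: hL ht; rewrite eL /ins; case: y1 {eL} => //=; case: t => -[].
Qed.

Lemma ins_catl v t (y : seq nat * seq nat) Z :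
  ins N v t (y.1, y.2 ++ 1 :: Z) = ins N v t y ++ 1 :: Z.
Proof. by rewrite /ins /= !catA -!catA /= !catA. Qed.

(** Serves both phases: [op] tells whether the run of 1 is open, [cc] whether [nu] charges the new
    letter. One gap is replaced by [t.1 + t.2] gaps, whence the argument [(p + t.1 + t.2).-1] of
    [x]. *)
Lemma left_step i L Z p r (op cc : bool) (x : nat -> nat -> K) (v := i.+1) :
  0 < i < n -> valid n i (L ++ 1 :: Z) -> head 0 L = N -> 1 \notin L ->
  count_mem N L = p.+1 -> count_mem N Z = r + op ->
  (v < last 1 (inc_prefix 1 Z)) = op ->
  (v <= last 1 (inc_prefix 1 Z)) && has_low v N (inc_rest 1 Z) = cc ->
  (forall t y, y \in gaps N t L ->
     [/\ valid n v (ins N v t y ++ 1 :: Z), head 0 (ins N v t y) = N,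
         1 \notin ins N v t y & count_mem N (ins N v t y) = (p + t.1 + t.2).-1.+1] ->
     fib v (ins N v t y ++ 1 :: Z) = x (p + t.1 + t.2).-1 r) ->
  (\sum_(t <- types) \sum_(y <- gaps N t L)
     q ^+ wt N v (ins N v t (y.1, y.2 ++ 1%N :: Z))
       * fib v (ins N v t (y.1, y.2 ++ 1%N :: Z))
   = q ^+ cc * lop q x p r)%R.
Proof.
move=> /andP[i0 lt_in] vs hL L1 cL cZ opE ccE hF.
apply: sum_left (cL) _ => t y hy.
have hyL : y \in splits N L by move: hy; rewrite mem_filter => /andP[].
have ht : t.1 || (0 < count_mem N y.1) by move: hy; rewrite mem_filter => /andP[].
have eL : L = y.1 ++ N :: y.2 by apply/eqP; rewrite -mem_splits.
have cy : count_mem N y.1 + count_mem N y.2 = p.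
  by apply: succn_inj; rewrite -cL eL count_cat /= eqxx; lia.
have vnots := notin_valid lt_in vs.
have hy' : (y.1, y.2 ++ 1 :: Z) \in gaps N t (L ++ 1 :: Z).
  by rewrite mem_filter ht mem_splits /= eL -catA.
have v1 : (1 == v) = false by apply/eqP; rewrite /v; lia.
have N1 : (1 == N) = false by apply/eqP; lia.
have n1 : 1 \notin ins N v t y.
  move: L1; rewrite eL /ins -catA !mem_cat !inE !mem_cat !mem_nseq N1 v1 !andbF /=.
  by [].
have vv := valid_ins lt_in vs hy'.
have vN : v != N by rewrite /v eqSS; apply/eqP; lia.
have [cs hs _] := vs.
rewrite (@wt_ins N i (L ++ 1 :: Z) t (y.1, y.2 ++ 1 :: Z)) // -/v.
rewrite ins_catl in vv *.
rewrite after_cat // opE ccE /=.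
have -> : (v == 1) = false by rewrite eq_sym.
have -> : (1 \in y.1) = false.
  by apply/negbTE; apply: contra L1; rewrite eL mem_cat => ->.
have -> /= : (v \in inc_prefix 1 Z) = false.
  apply/negbTE; apply: contra vnots => /mem_inc_prefix hv.
  by rewrite mem_cat inE hv !orbT.
have -> : count_mem N (y.2 ++ 1 :: Z) = p + r + op - count_mem N y.1.
  by rewrite count_cat /= cZ N1 -cy -!addnA addKn.
rewrite wgt_left // ?(leq_trans _ (leq_addr _ _)) -?cy ?leq_addr //.
rewrite hF //; last first.
  split=> //; first exact: ins_head hy.
  rewrite count_ins // -cy; case: t ht {hy hy' n1 vv} => -[] [] /=; lia.
rewrite exprD cy [(q ^+ expL _ _ _ * _)%R]mulrC -mulrA; congr (_ * (_ * _))%R.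
by case: t {ht hy hy' n1 vv} => -[] [] /=; rewrite ?addn0 ?addn1.
Qed.

(** If the run of 1 is open, [R] includes its gap. As [T] does not begin with a gap, the insertions
    considered here leave that run untouched; those into its own gap are treated in [wt_gap]. *)
Lemma right_step i L R T p r (op cc : bool) (x : nat -> nat -> K) (v := i.+1) :
  0 < i < n -> valid n i (L ++ 1 :: R ++ T) -> head 0 L = N -> 1 \notin L ->
  count_mem N L = p.+1 -> count_mem N R = op -> count_mem N T = r ->
  path ltn 1 R -> head 0 T <= last 1 R -> head 0 T != N ->
  (v < last 1 R) = op -> (v <= last 1 R) && has_low v N T = cc ->
  (forall t y, y \in splits N T ->
     [/\ valid n v (L ++ 1 :: R ++ ins N v t y), head 0 (ins N v t y) = head 0 T,
         y.1 != [::], v \notin T & count_mem N (ins N v t y) = (r + t.1 + t.2).-1] ->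
     fib v (L ++ 1 :: R ++ ins N v t y) = x p (r + t.1 + t.2).-1) ->
  (\sum_(t <- types) \sum_(y <- splits N T)
     q ^+ wt N v (ins N v t (L ++ 1%N :: R ++ y.1, y.2))
       * fib v (ins N v t (L ++ 1%N :: R ++ y.1, y.2))
   = q ^+ (2 * cc) * rop q x p r)%R.
Proof.
move=> /andP[i0 lt_in] vs hL L1 cL cR cT pR hRT hTN opE ccE hF.
apply: sum_right (cT) _ => t y hy.
have eT : T = y.1 ++ N :: y.2 by apply/eqP; rewrite -mem_splits.
have cy : count_mem N y.1 + (count_mem N y.2).+1 = r.
  by rewrite -cT eT count_cat /= eqxx.
have vnots := notin_valid lt_in vs.
have v1 : (v == 1) = false by apply/eqP; rewrite /v; lia.
have N1 : (1 == N) = false by apply/eqP; lia.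
have vN : v != N by rewrite /v eqSS; apply/eqP; lia.
have hy' : (L ++ 1 :: R ++ y.1, y.2) \in gaps N t (L ++ 1 :: R ++ T).
  rewrite mem_filter mem_splits /= eT /= -!catA /= -!catA eqxx andbT.
  by rewrite count_cat cL orbT.
have vv := valid_ins lt_in vs hy'.
have [cs hs _] := vs.
have y10 : y.1 != [::] by apply: contra hTN => /eqP y0; rewrite eT y0.
have hI : head 0 (ins N v t y) = head 0 T.
  by rewrite eT /ins; case: (y.1) y10.
rewrite (@wt_ins N i (L ++ 1 :: R ++ T) t (L ++ 1 :: R ++ y.1, y.2)) // -/v.
have insE : ins N v t (L ++ 1 :: R ++ y.1, y.2) = L ++ 1 :: R ++ ins N v t y.
  by rewrite /ins /= -!catA /= -!catA.
rewrite {}insE in vv *; rewrite after_cat // v1.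
have [|-> ->] := @inc_cat 1 R (ins N v t y) pR; first by rewrite hI.
rewrite opE.
have -> : has_low v N (ins N v t y) = has_low v N T.
  by rewrite [in RHS]eT; case: (y) => y1 y2; rewrite has_low_ins.
rewrite ccE.
have -> : (v \in R) = false.
  apply/negbTE; apply: contra vnots => hv.
  by rewrite mem_cat inE mem_cat hv !orbT.
have -> : (1 \in (L ++ 1 :: R ++ y.1, y.2).1) by rewrite /= mem_cat mem_head orbT.
have -> : count_mem N (L ++ 1 :: R ++ y.1, y.2).1 = p + 1 + op + count_mem N y.1.
  by rewrite /= count_cat /= count_cat cL cR N1 add0n addn1 !addnA.
have -> : count_mem N (L ++ 1 :: R ++ y.1, y.2).2 = r - 1 - count_mem N y.1.
  by rewrite -cy /= addnS subn1 /= addKn.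
rewrite wgt_right; last by rewrite -cy addnS ltnS leq_addr.
rewrite hF //; last first.
  split=> //; first by apply: contra vnots => hv; rewrite mem_cat inE mem_cat hv !orbT.
  by rewrite count_ins // -cy; case: (t) => -[] [] /=; lia.
rewrite exprD [(q ^+ expR _ _ _ * _)%R]mulrC -mulrA; congr (_ * (_ * _))%R.
by case: (t) => -[] [] /=; rewrite ?addn0 ?addn1.
Qed.

(* The run of 1 is open; [mu] tells whether the singleton [c] is already present. *)
Definition phaseA i s p r mu := exists L R T,
  [/\ s = L ++ 1 :: R ++ N :: T, head 0 L = N, 1 \notin L, path ltn 1 R
    & last 1 R <= i]
  /\ [/\ count_mem N L = p.+1, count_mem N T = r & has_low i.+1 N T = mu].

(** The run of 1 is closed: a smaller letter or, through the default 0, the end of the word follows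
    it. *)
Definition phaseB i s p r := exists L R T,
  [/\ s = L ++ 1 :: R ++ T, head 0 L = N, 1 \notin L, path ltn 1 R
    & head 0 T < last 1 R]
  /\ [/\ last 1 R <= i, count_mem N L = p.+1 & count_mem N T = r].

Lemma count_run i R : i < N -> path ltn 1 R -> last 1 R <= i -> count_mem N R = 0.
Proof.
move=> ltN pR lR; apply/eqP; rewrite -leqn0 leqNgt -has_count has_pred1.
by apply/negP => /(@mem_behead _ (1 :: R)) /(path_ltn_last pR); lia.
Qed.

Lemma splits_run i R T : i < N -> path ltn 1 R -> last 1 R <= i ->
  splits N (R ++ T) = [seq (R ++ y.1, y.2) | y <- splits N T].
Proof.
move=> ltN pR lR; rewrite splits_cat; suff -> : splits N R = [::] by [].
case E: (splits N R) => [|y l] //; have : y \in splits N R by rewrite E mem_head.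
rewrite mem_splits => /eqP eR; have := count_run ltN pR lR.
by rewrite eR count_cat /= eqxx addnS.
Qed.

Lemma head_rest i s A T : i < n -> valid n i s -> s = A ++ N :: T ->
  (head 0 T != N) && (head 0 T <= i).
Proof.
move=> lt_in [cs _ _] es; have lt_iN : i < N by apply: ltnW.
have hy : (A, T) \in splits N s by rewrite mem_splits /= es.
have := head_neqN lt_iN cs hy; case: T es {hy} => //= x T es /(_ T).
rewrite eqseq_cons eqxx andbT => xN; rewrite xN /=.
have : x \in coll N i 0 s by rewrite cs es mem_cat !inE eqxx !orbT.
by move/(allP (all_coll _ _ _ _)) => /=; rewrite (negPf xN) orbF.
Qed.

Lemma phaseB_rec i s p r (x : nat -> nat -> K) :
  0 < i < n -> valid n i s -> phaseB i s p r ->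
  (forall s' p' r', valid n i.+1 s' -> phaseB i.+1 s' p' r' ->
     fib i.+1 s' = x p' r') ->
  (fib i s = lop q x p r + rop q x p r)%R.
Proof.
move=> i0n vs [L [R [T [[es hL L1 pR hT] [lR cL cT]]]]] hx; subst s.
have /andP[i0 lt_in] := i0n; have lt_iN : i < N by apply: ltnW.
rewrite fiber_expand // (splits_run _ lt_iN) //.
have [iP iR] := inc_cat pR (ltnW hT).
have cR := count_run lt_iN pR lR.
have nlt : (i.+1 < last 1 R) = false by lia.
have nle : (i.+1 <= last 1 R) = false by lia.
have hTN : head 0 T != N by apply/eqP; lia.
rewrite (left_step (p := p) (r := r) (op := false) (cc := false) (x := x)) //;
  rewrite ?iP ?iR ?nle ?nlt ?count_cat ?cR ?cT ?addn0 //; last first.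
  move=> t y _ [vs' hs' s1 cs']; apply: hx => //.
  by exists (ins N i.+1 t y), R, T; do 2?split=> //; lia.
rewrite expr0 mul1r; congr (_ + _)%R.
under eq_bigr do rewrite big_map.
rewrite (right_step (p := p) (r := r) (op := false) (cc := false) (x := x)) //.
- by rewrite mul1r.
- exact: ltnW.
- by rewrite nle.
move=> t y _ [vs' hs' y1 vT cs']; apply: hx => //.
exists L, R, (ins N i.+1 t y); do 2?split=> //; last lia.
by rewrite hs'.
Qed.

Definition expG (t : bool * bool) (p r : nat) : nat :=
  match t with
  | (true, true) => p + r + 3 + p
  | (true, false) => p + r + 1 + p
  | _ => p + r + p
  end.

(** Insertion into the gap of the run of 1 itself: an opener or singleton starts a new run and
    leaves the run of 1 open, a continuator or closer joins it. A closer is the final d, still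
    charged by [nu] since the range is c < v <= d. *)
Lemma wt_gap i L R T t p r mu (v := i.+1) :
  0 < i < n -> valid n i (L ++ 1 :: R ++ N :: T) -> head 0 L = N -> 1 \notin L ->
  path ltn 1 R -> last 1 R <= i -> count_mem N L = p.+1 -> count_mem N T = r ->
  has_low v N T = mu ->
  wt N v (ins N v t (L ++ 1 :: R, T)) = expG t p r + 2 * mu.
Proof.
move=> /andP[i0 lt_in] vs hL L1 pR lR cL cT hmu.
have lt_iN : i < N by apply: ltnW.
have es : L ++ 1 :: R ++ N :: T = (L ++ 1 :: R) ++ N :: T by rewrite -catA.
have /andP[TN Ti] := head_rest lt_in vs es.
have cR := count_run lt_iN pR lR.
have vnots := notin_valid lt_in vs.
have v1 : (v == 1) = false by apply/eqP; rewrite /v; lia.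
have vN : (v == N) = false by rewrite /v eqSS; apply/eqP; lia.
have Nv : (N < v) = false by rewrite /v; lia.
have N1 : (1 == N) = false by apply/eqP; lia.
have lt_vN : v < N by [].
have ltRv : last 1 R < v by [].
have ltRN : last 1 R < N by lia.
have nR : (v \in R) = false.
  apply/negbTE; apply: contra vnots => hv.
  by rewrite mem_cat inE mem_cat hv !orbT.
have hy : (L ++ 1 :: R, T) \in gaps N t (L ++ 1 :: R ++ N :: T).
  by rewrite mem_filter mem_splits es eqxx /= count_cat cL orbT.
have [cs hs _] := vs.
rewrite (@wt_ins N i _ t _ lt_vN cs hs hy) -/v v1.
have -> : ins N v t (L ++ 1 :: R, T) = L ++ 1 :: ins N v t (R, T).
  by rewrite /ins /= -!catA.
rewrite after_cat //.
have -> : (1 \in (L ++ 1 :: R, T).1) by rewrite /= mem_cat mem_head orbT.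
have -> : count_mem N (L ++ 1 :: R, T).1 = p.+1.
  by rewrite /= count_cat /= cL N1 cR !addn0.
rewrite -[(L ++ 1 :: R, T).2]/T cT.
have RN : path ltn 1 (rcons R N) by rewrite rcons_path pR.
have Rv : path ltn 1 (rcons R v) by rewrite rcons_path pR.
have RvN : path ltn 1 (rcons (rcons R v) N) by rewrite rcons_path Rv last_rcons.
have hTv : head 0 T <= v by apply: leqW.
have hTN : head 0 T <= N by apply: leq_trans hTv (ltnW lt_vN).
rewrite /ins; case: t {hy} => -[] [] /=; rewrite ?cats0 ?cats1.
- have [|-> ->] := @inc_cat 1 (rcons R N) (v :: N :: T) RN.
    by rewrite last_rcons /= ltnW.
  rewrite !last_rcons mem_rcons inE vN nR lt_vN (ltnW lt_vN) /= ltnn Nv hmu.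
  by rewrite /wgt /=; case: mu {hmu} => /=; lia.
- have [|-> ->] := @inc_cat 1 (rcons R N) (v :: T) RN.
    by rewrite last_rcons /= ltnW.
  rewrite !last_rcons mem_rcons inE vN nR lt_vN (ltnW lt_vN) /= ltnn hmu.
  by rewrite /wgt /=; case: mu {hmu} => /=; lia.
- rewrite -!cat_rcons.
  have [|-> ->] := @inc_cat 1 (rcons (rcons R v) N) T RvN.
    by rewrite last_rcons.
  rewrite !last_rcons !(mem_rcons, inE) eqxx orbT lt_vN (ltnW lt_vN) /= hmu.
  by rewrite /wgt /=; case: mu {hmu} => /=; lia.
rewrite -!cat_rcons.
have [|-> ->] := @inc_cat 1 (rcons R v) T Rv; first by rewrite last_rcons.
rewrite !last_rcons !mem_rcons !inE eqxx ltnn leqnn /= hmu.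
by rewrite /wgt /=; case: mu {hmu} => /=; lia.
Qed.

(** Besides the insertions on either side, the gap of the run of 1 gives four terms: an opener adds
    an open run on the right, a singleton is a candidate for c ([xt]), a continuator changes neither
    count, a closer leads to the other phase ([xb]). *)
Lemma phaseA_rec i s p r mu (xa xb : nat -> nat -> K) xt :
  0 < i < n -> valid n i s -> phaseA i s p r mu ->
  (forall s' p' r', valid n i.+1 s' -> phaseA i.+1 s' p' r' mu ->
     fib i.+1 s' = xa p' r') ->
  (forall s', valid n i.+1 s' -> phaseA i.+1 s' p r true -> fib i.+1 s' = xt) ->
  (forall s' p' r', valid n i.+1 s' -> phaseB i.+1 s' p' r' ->
     fib i.+1 s' = xb p' r') ->
  (fib i s = q ^+ mu * lop q xa p r + q ^+ (2 * mu)
     * (rop q xa p r + q ^+ (p + r + 3 + p) * xa p r.+1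
        + q ^+ (p + r + 1 + p) * xt
        + q ^+ (p + r + p) * xa p r + q ^+ (p + r + p) * xb p r))%R.
Proof.
move=> i0n vs [L [R [T [[es hL L1 pR lR] [cL cT hmu]]]]] ha ht hb; subst s.
have /andP[i0 lt_in] := i0n; have lt_iN : i < N by apply: ltnW.
have lt_vN : i.+1 < N by [].
have cR := count_run lt_iN pR lR.
have es : L ++ 1 :: R ++ N :: T = (L ++ 1 :: R) ++ N :: T by rewrite -catA.
have /andP[TN Ti] := head_rest lt_in vs es.
have vnots := notin_valid lt_in vs.
have vT : i.+1 \notin T.
  by apply: contra vnots => hv; rewrite mem_cat inE mem_cat inE hv !orbT.
have ltRN : last 1 R < N by lia.
have RN : path ltn 1 (rcons R N) by rewrite rcons_path pR.
have Rv : path ltn 1 (rcons R i.+1) by rewrite rcons_path pR.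
have hTN : head 0 T <= last 1 (rcons R N) by rewrite last_rcons; lia.
have [iP iR] := inc_cat RN hTN.
rewrite fiber_expand // (splits_run _ lt_iN) // -cat_rcons.
rewrite (left_step (p := p) (r := r) (op := true) (cc := mu) (x := xa)) //;
  rewrite ?cat_rcons // -?cat_rcons ?iP ?iR ?last_rcons ?(ltnW lt_vN) //.
- congr (_ + _)%R.
  have spl : splits N (N :: T) = ([::], T) :: [seq (N :: y.1, y.2) | y <- splits N T].
    by rewrite /= eqxx.
  under eq_bigr do rewrite big_map spl big_cons big_map.
  rewrite big_split /= cats0.
  have -> : (\sum_(t <- types) \sum_(y <- splits N T)
     q ^+ wt N i.+1 (ins N i.+1 t (L ++ 1%N :: R ++ N :: y.1, y.2))
       * fib i.+1 (ins N i.+1 t (L ++ 1%N :: R ++ N :: y.1, y.2))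
     = q ^+ (2 * mu) * rop q xa p r)%R.
    under eq_bigr do under eq_bigr do rewrite -[N :: _]cat1s catA.
    apply: (right_step (op := true) (cc := mu)) => //.
    - by rewrite -catA.
    - by rewrite count_cat cR /= eqxx.
    - by rewrite cats1.
    - by rewrite cats1.
    - by rewrite cats1 last_rcons.
    - by rewrite cats1 last_rcons (ltnW lt_vN).
    move=> t y hy [vs' hs' y1 vT' cs']; apply: ha => //.
    exists L, R, (ins N i.+1 t y); do 2?split=> //.
    - by rewrite -catA.
    - exact: leqW.
    have eT : T = y.1 ++ N :: y.2 by apply/eqP; rewrite -mem_splits.
    rewrite -hmu [in RHS]eT.
    case: (y) eT y1 => y1 y2 /= eT y10; apply: has_lowS_ins => //.
    - by apply: contra vT; rewrite eT mem_cat => ->.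
    - by apply: contra vT; rewrite eT mem_cat inE => ->; rewrite !orbT.
    case: y1 y10 eT => //= z y1 _ eT; move: Ti; rewrite eT /= => zi.
    by apply/orP; right; apply/orP; left.
  pose X t := match t with
    | (true, true) => xa p r.+1 | (true, false) => xt
    | (false, true) => xa p r | _ => xb p r end.
  have gE t : (q ^+ wt N i.+1 (ins N i.+1 t (L ++ 1%N :: R, T))
      * fib i.+1 (ins N i.+1 t (L ++ 1%N :: R, T))
      = q ^+ (2 * mu) * (q ^+ expG t p r * X t))%R.
    rewrite (@wt_gap i L R T t p r mu) // exprD [(q ^+ expG _ _ _ * _)%R]mulrC -mulrA.
    congr (_ * (_ * _))%R.
    have hy : (L ++ 1 :: R, T) \in gaps N t (L ++ 1 :: R ++ N :: T).
      by rewrite mem_filter mem_splits es eqxx /= count_cat cL orbT.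
    have vv := valid_ins lt_in vs hy.
    have lowT : has_low i.+2 N T = mu by rewrite -hmu; apply: has_lowS.
    case: t hy vv => -[] [] /= _; rewrite /ins /= ?cats0 -?catA => vv.
    - apply: ha => //; exists L, R, (i.+1 :: N :: T).
      do 2?split=> //; first exact: leqW.
        by rewrite /= eqxx cT (ltn_eqF lt_vN).
      have N2 : N < i.+2 = false by lia.
      have NS : N < i.+1 = false by lia.
      rewrite /= ltnSn N2 NS andbF /= -hmu; apply: has_lowS => // x hx.
      by rewrite leq_min hx.
    (* The new letter comes first after the run of 1 and is followed by a letter <= [i] or by
       nothing: a left-to-right minimum forming a singleton run. *)
    - apply: ht => //; exists L, R, (i.+1 :: T).
      do 2?split=> //; first exact: leqW.
        by rewrite /= cT (ltn_eqF lt_vN).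
      by rewrite /= ltnSn lt_vN ltnS Ti.
    - apply: ha => //; exists L, (rcons R i.+1), T.
      by rewrite cat_rcons; do 2?split=> //; rewrite last_rcons.
    apply: hb => //; exists L, (rcons R i.+1), T.
    by rewrite cat_rcons; do 2?split=> //; rewrite last_rcons.
  rewrite (eq_bigr _ (fun t _ => gE t)) /types !big_cons big_nil /=; ring.
- by rewrite count_cat -cats1 count_cat cR cT /= eqxx addnC.
move=> t y hy [vs' hs' s1 cs']; apply: ha => //.
exists (ins N i.+1 t y), R, T; rewrite cat_rcons; do 2?split=> //.
  exact: leqW.
by rewrite -hmu; apply: has_lowS.
Qed.

Lemma fiberB m i s p r : i + m = n -> 0 < i -> valid n i s -> phaseB i s p r ->
  fib i s = bsum q m p r.
Proof.
elim: m i s p r => [|m IH] i s p r im i0 vs hs.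
  move: vs; rewrite addn0 in im; rewrite im => vs; rewrite fiber_last //.
  case: hs => L [R [T [[-> _ _ pR _] [lR cL cT]]]].
  have lt_iN : i < N by rewrite im.
  rewrite count_cat /= count_cat (count_run lt_iN pR lR) cL cT.
  have -> : (1 == N) = false by lia.
  by congr (_%:R)%R; case: p r {cL cT} => [|p] [|r] //=; lia.
have i0n : 0 < i < n by apply/andP; split; lia.
rewrite (phaseB_rec (x := bsum q m) i0n vs hs) //.
by move=> s' p' r' vs' hs'; apply: IH => //; lia.
Qed.

(** The gap of the run of 1 acts as an additional open run on the right: its four insertions match
    the isolated terms of [rop_shift], and the charges q and q^2 of [nu] match the shifts of [lop]
    and [rop]. The closer keeps its own charge, which is the factor q^2. *)
Lemma fiberA2 m i s p r : i + m = n -> 0 < i -> valid n i s ->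
  phaseA i s p r true -> (fib i s = q ^+ 2 * bsum q m p r.+1)%R.
Proof.
elim: m i s p r => [|m IH] i s p r im i0 vs hs.
  move: vs; rewrite addn0 in im; rewrite im => vs; rewrite fiber_last //.
  case: hs => L [R [T [[-> _ _ pR lR] [cL cT _]]]].
  have lt_iN : i < N by rewrite im.
  rewrite count_cat /= count_cat (count_run lt_iN pR lR) cL /= eqxx.
  by rewrite andbF mulr0 !addnS.
have i0n : 0 < i < n by apply/andP; split; lia.
have IHm : i.+1 + m = n by lia.
rewrite (phaseA_rec (xa := (fun p r => q ^+ 2 * bsum q m p r.+1)%R)
  (xb := bsum q m) (xt := (q ^+ 2 * bsum q m p r.+1)%R) i0n vs hs) /=.
- rewrite lop_shift rop_shift.
  have lopZ c x a b : lop q (fun p r => c * x p r.+1)%R a b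
      = (c * lop q (fun p r => x p r.+1) a b)%R.
    rewrite /lop mulrDr !mulr_sumr; congr (_ + _)%R; apply: eq_bigr => j _; ring.
  have ropZ c x a b : rop q (fun p r => c * x p r.+1)%R a b
      = (c * rop q (fun p r => x p r.+1) a b)%R.
    rewrite /rop mulr_sumr; apply: eq_bigr => j _; ring.
  rewrite lopZ ropZ !exprD !exprS; ring.
- by move=> s' p' r' vs' hs'; apply: IH.
- by move=> s' vs' hs'; apply: IH.
by move=> s' p' r' vs' hs'; apply: fiberB.
Qed.

Lemma fiberA1 m i s p r : i + m = n -> 0 < i -> valid n i s ->
  phaseA i s p r false -> (fib i s = fsum q m (p + r) - bsum q m p r)%R.
Proof.
elim: m i s p r => [|m IH] i s p r im i0 vs hs.
  move: vs; rewrite addn0 in im; rewrite im => vs; rewrite fiber_last //.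
  case: hs => L [R [T [[-> _ _ pR lR] [cL cT _]]]].
  have lt_iN : i < N by rewrite im.
  rewrite count_cat /= count_cat (count_run lt_iN pR lR) cL /= eqxx.
  by rewrite fsum0 addn_eq0 subrr !addnS.
have i0n : 0 < i < n by apply/andP; split; lia.
have IHm : i.+1 + m = n by lia.
rewrite (phaseA_rec (xa := (fun p r => fsum q m (p + r) - bsum q m p r)%R)
  (xb := bsum q m) (xt := (q ^+ 2 * bsum q m p r.+1)%R) i0n vs hs).
- have lopB x y a b : lop q (fun p r => x p r - y p r)%R a b
      = (lop q x a b - lop q y a b)%R.
    rewrite /lop opprD addrACA -!sumrB; congr (_ + _)%R; apply: eq_bigr => j _; ring.
  have ropB x y a b : rop q (fun p r => x p r - y p r)%R a b
      = (rop q x a b - rop q y a b)%R.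
    rewrite /rop -sumrB; apply: eq_bigr => j _; ring.
  (* The singleton term q^(p+r+1+p) q^2 B(p, r+1) cancels the B-part of the opener term, the closer
     term that of the continuator term; what is left is [fsum_rec] minus the recurrence of
     [bsum]. *)
  rewrite fsum_rec lopB ropB /= !exprD !exprS; ring.
- by move=> s' p' r' vs' hs'; apply: IH.
- by move=> s' vs' hs'; apply: fiberA2.
by move=> s' p' r' vs' hs'; apply: fiberB.
Qed.

End Phases.

(** * The statistic as a sum of letter weights *)

Lemma inc_prefix_rest a s : inc_prefix a s ++ inc_rest a s = s.
Proof. by elim: s a => //= x s IH a; case: ifP => //= _; rewrite IH. Qed.

Lemma path_inc_prefix a s : path ltn a (inc_prefix a s).
Proof. by elim: s a => //= x s IH a; case: ifP => //= ->; rewrite IH. Qed.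

Lemma head_inc_rest a s : head 0 (inc_rest a s) <= last a (inc_prefix a s).
Proof. by elim: s a => //= x s IH a; case: ltnP => //= _; apply: IH. Qed.

Lemma crossings_nth v a s :
  crossings v a s =
  count (fun j => (nth 0 (a :: s) j < v) && (v < nth 0 (a :: s) j.+1)) (iota 0 (size s)).
Proof.
elim: s a => //= x s IH a; rewrite {}IH; congr (_ + _).
by rewrite (iotaDl 1 0) count_map; apply: eq_count => j /=.
Qed.

Lemma has_lowP v m s :
  reflect (exists k, [/\ k < size s, nth 0 s k < minn v m,
             forall k', k' < k -> nth 0 s k < nth 0 s k'
             & nth 0 s k.+1 < nth 0 s k])
    (has_low v m s).
Proof.
apply: (iffP idP).
  elim: s m => //= x s IH m; case: ifP => xv; last first.
    move/IH => [k [ks kv hk kl]]; exists k.+1; split=> // -[|k'] //= hk'; last exact: hk.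
    by move: kv xv; rewrite leq_min => /andP[+ _]; lia.
  case/orP => [/andP[xm hx]|/IH [k [ks kv hk kl]]].
    by exists 0; split=> //=; rewrite ?leq_min ?xv ?nth0.
  exists k.+1; split=> //=; first by move: kv; rewrite !leq_min => /and3P[-> _ ->].
  by move=> [|k'] //= hk'; [move: kv; rewrite !leq_min => /and3P[] | apply: hk].
elim: s m => [|x s IH] m [k [//= ks kv hk kl]].
case: k ks kv hk kl => [|k] /= ks kv hk kl.
  move: kv; rewrite leq_min => /andP[xv xm]; rewrite xv xm /=.
  by move: kl; rewrite nth0 => ->.
have kx : nth 0 s k < x by exact: (hk 0).
have hk' k' : k' < k -> nth 0 s k < nth 0 s k' by move=> h; exact: (hk k'.+1).
move: kv; rewrite leq_min => /andP[kv km].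
case: ifP => xv; last by apply: IH; exists k; rewrite leq_min kv km.
by apply/orP; right; apply: IH; exists k; rewrite !leq_min kv km kx.
Qed.

(** With [r] the run of 1, this and the next lemma express the starred counts as plain straddle
    counts with one correction. *)
Lemma count_neq_and r (P : pred nat) s : uniq s ->
  count (fun x => (x != r) && P x) s = count P s - ((r \in s) && P r).
Proof.
elim: s => //= x s IH /andP[xs us]; rewrite IH // inE eq_sym.
case: eqP => [->|_] /=; last first.
  case hr : ((r \in s) && P r) => /=; rewrite ?subn0 //.
  have : 0 < count P s by rewrite -has_count; apply/hasP; exists r; case/andP: hr.
  by case: (P x) => //=; lia.
by rewrite (negPf xs) /= subn0 addKn.
Qed.

Lemma count_eq_or r (P : pred nat) s : uniq s ->
  count (fun x => (x == r) || P x) s = count P s + ((r \in s) && ~~ P r).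
Proof.
elim: s => //= x s IH /andP[xs us]; rewrite IH // inE eq_sym.
case: eqP => [->|_] /=; last by rewrite addnA.
by rewrite (negPf xs) /= addn0; case: (P x) => /=; lia.
Qed.

Lemma count_itv n c d : count (fun v => c < v <= d) (iota 1 n) = minn n d - c.
Proof.
elim: n => [|n IH]; first by rewrite min0n.
rewrite -(addn1 n) iotaD count_cat IH /= addn0 add1n addn1.
by case: (leqP n.+1 d); case: (ltnP c n.+1) => ? ? /=; lia.
Qed.

Local Arguments wat w p : simpl never.

Section WordStat.
Variables (n : nat) (w : seq nat).
Hypotheses (n_gt0 : 0 < n) (w_perm : perm_eq w (iota 1 n)).
Local Notation N := n.+1.
Local Notation "w_[ p ]" := (wat w p) (at level 0).

Lemma size_w : size w = n. Proof. by rewrite (perm_size w_perm) size_iota. Qed.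
Lemma uniq_w : uniq w. Proof. by rewrite (perm_uniq w_perm) iota_uniq. Qed.
Lemma mem_w x : (x \in w) = (0 < x <= n).
Proof. by rewrite (perm_mem w_perm) mem_iota add1n ltnS. Qed.

Lemma wat_bounds p : p < n -> 0 < w_[p] <= n.
Proof. by move=> pn; rewrite -mem_w mem_nth ?size_w. Qed.

Lemma wat_out p : n <= p -> w_[p] = 0.
Proof. by move=> np; rewrite /wat nth_default ?size_w. Qed.

Lemma wat_inj p p' : p < n -> p' < n -> w_[p] = w_[p'] -> p = p'.
Proof. by move=> pn pn' /eqP; rewrite nth_uniq ?size_w ?uniq_w // => /eqP. Qed.

Lemma index_wat p : p < n -> index w_[p] w = p.
Proof. by move=> pn; rewrite index_uniq ?size_w ?uniq_w. Qed.

Lemma count_starts p : count (run_start w) (iota 0 p.+1) = (rid w p).+1.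
Proof. by rewrite /rid. Qed.

Lemma ridS p : rid w p.+1 = rid w p + run_start w p.+1.
Proof.
apply: succn_inj; rewrite -count_starts -[p.+2]addn1 iotaD count_cat.
by rewrite count_starts /= addn0.
Qed.

Lemma rid_mono p p' : p <= p' -> rid w p <= rid w p'.
Proof.
move=> /subnK <-; elim: (p' - p) => // k IH; rewrite addSn ridS.
exact: leq_trans IH (leq_addr _ _).
Qed.

Lemma rid_lt_nrun p : p < n -> rid w p < nrun w.
Proof.
move=> pn; rewrite -count_starts /nrun /wlen size_w -(subnKC pn) iotaD count_cat.
exact: leq_addr.
Qed.

Lemma wat_step p : p.+1 < n -> ~~ run_start w p.+1 -> w_[p] < w_[p.+1].
Proof.
move=> pn; rewrite /run_start /= -leqNgt leq_eqVlt => /orP[/eqP|//].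
by move/(wat_inj (ltnW pn) pn)/eqP; rewrite eqn_leq ltnn andbF.
Qed.

Lemma wat_run p p' : p < p' -> p' < n -> rid w p = rid w p' -> w_[p] < w_[p'].
Proof.
move=> lt_pp'; rewrite -(subnKC lt_pp'); elim: (p' - p.+1) => [|k IH].
  rewrite addn0 ridS => pn e; apply: wat_step => //.
  by apply/negP => s; move: e; rewrite s; lia.
rewrite addnS => pn e; have e' : rid w p = rid w (p.+1 + k).
  apply/eqP; rewrite eqn_leq rid_mono /=; last lia.
  by rewrite e rid_mono.
apply: ltn_trans (IH (ltnW pn) e') (wat_step pn _).
by apply/negP => s; move: e; rewrite e' ridS s; lia.
Qed.

Lemma mem_run_vals p r : p < n -> (w_[p] \in run_vals w r) = (rid w p == r).
Proof.
move=> pn; apply/mapP/eqP => [[p' ]|e].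
  rewrite mem_filter mem_iota /= add0n /wlen size_w => /andP[/eqP <- hp] e.
  by rewrite (wat_inj pn hp e).
by exists p => //; rewrite mem_filter mem_iota /wlen size_w e eqxx.
Qed.

Lemma run_valsP r x :
  reflect (exists p, [/\ p < n, rid w p = r & x = w_[p]]) (x \in run_vals w r).
Proof.
apply: (iffP mapP) => [[p]|[p [pn e ->]]].
  by rewrite mem_filter mem_iota /= add0n /wlen size_w => /andP[/eqP <- hp] ->; exists p.
by exists p => //; rewrite mem_filter mem_iota /wlen size_w e eqxx.
Qed.

Definition cross v k := [&& 0 < k, w_[k.-1] < v & v < w_[k]].

Lemma crossP v k : cross v k -> k < n ->
  exists2 j, k = j.+1 & [/\ rid w k = rid w j, w_[j] < v & v < w_[k]].
Proof.
case: k => [|j] /and3P[//= _ h1 h2] jn; exists j => //; split=> //.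
by rewrite ridS /run_start /= ltnNge (ltnW (ltn_trans h1 h2)) addn0.
Qed.

(** A discrete intermediate value argument; [v] is no letter of run [r], so the run must jump over
    it. *)
Lemma cross_exists p r p1 p2 (v := w_[p]) : p < n -> rid w p != r ->
  rid w p1 = r -> rid w p2 = r -> p2 < n -> p1 <= p2 -> w_[p1] < v -> v < w_[p2] ->
  exists k, [/\ k < n, cross v k & rid w k = r].
Proof.
move=> pn npr e1 e2 p2n /subnK; rewrite addnC; move: (p2 - p1) => k.
elim: k p1 e1 => [|k IH] p1 e1.
  by rewrite addn0 => -> h1 h2; move: (ltn_trans h1 h2); rewrite ltnn.
rewrite addnS -addSn => e h1 h2.
have e1' : rid w p1.+1 = r.
  apply/eqP; rewrite eqn_leq -{1}e2 -e1 !rid_mono //.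
  by rewrite -e leq_addr.
have p1n : p1.+1 < n by apply: leq_ltn_trans p2n; rewrite -e leq_addr.
case: (ltngtP v w_[p1.+1]) => [lt|gt|eq].
- by exists p1.+1; rewrite /cross /= h1 lt.
- exact: IH e1' e gt h2.
by move: npr; rewrite (wat_inj pn p1n eq) e1' eqxx.
Qed.

(** Sending a crossing position to its run is a bijection onto the straddling runs: an increasing
    run crosses [v] at most once, and [cross_exists] gives surjectivity. *)
Lemma straddle_count p rs (v := w_[p]) : p < n -> uniq rs -> rid w p \notin rs ->
  count (fun r => straddles w r v) rs
  = count (fun k => cross v k && (rid w k \in rs)) (iota 0 n).
Proof.
move=> pn urs nrs; rewrite -!size_filter -[RHS](size_map (rid w)).
apply: perm_size; apply: uniq_perm.
- exact: filter_uniq.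
- rewrite map_inj_in_uniq ?filter_uniq ?iota_uniq // => k k'.
  rewrite !mem_filter !mem_iota /= !add0n => /andP[/andP[ck _] kn] /andP[/andP[ck' _] kn'] e.
  have [j ek [rk jv vk]] := crossP ck kn; have [j' ek' [rk' jv' vk']] := crossP ck' kn'.
  have aux a b : a.+1 <= b -> b.+1 < n -> rid w a.+1 = rid w b -> v < w_[a.+1] -> w_[b] < v -> False.
    rewrite leq_eqVlt => /orP[/eqP <-|ab] bn eab h1 h2; first lia.
    by have := wat_run ab (ltnW bn) eab; lia.
  case: (ltngtP k k') => // lt; exfalso.
    by apply: (aux j j'); rewrite -?ek -?ek' //; [rewrite ek ek' in lt * | congruence].
  by apply: (aux j' j); rewrite -?ek -?ek' //; [rewrite ek ek' in lt * | congruence].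
move=> r; rewrite mem_filter; apply/andP/mapP.
  case=> /andP[/hasP[x1 /run_valsP[p1 [p1n e1 ->]] h1] /hasP[x2 /run_valsP[p2 [p2n e2 ->]] h2]] hr.
  have npr : rid w p != r by apply: contra nrs => /eqP ->.
  have le12 : p1 <= p2.
    rewrite leqNgt; apply/negP => lt21.
    have := wat_run lt21 p1n (etrans e2 (esym e1)).
    by move=> h; have := ltn_trans h h1; rewrite ltnNge (ltnW h2).
  have [k [kn ck rk]] := cross_exists pn npr e1 e2 p2n le12 h1 h2.
  by exists k; rewrite // mem_filter mem_iota ck rk hr.
case=> k; rewrite mem_filter mem_iota /= add0n => /andP[/andP[ck hk] kn] ->.
have [j ek [rk jv vk]] := crossP ck kn; split=> //.
have jn : j < n by apply: leq_ltn_trans kn; rewrite ek.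
apply/andP; split; apply/hasP.
  by exists w_[j] => //; rewrite mem_run_vals // rk.
by exists w_[k] => //; rewrite mem_run_vals.
Qed.

Lemma run_endE p : p < n -> is_run_end w p = (w_[p.+1] < w_[p]).
Proof.
move=> pn; rewrite /is_run_end /wlen size_w /run_start /=.
case: eqP => //= e; rewrite (wat_out (p := p.+1)) ?e //.
by have /andP[-> _] := wat_bounds pn.
Qed.

Lemma run_len_gt1 p p' : p < n -> p' < n -> p != p' -> rid w p = rid w p' ->
  1 < run_len w (rid w p).
Proof.
move=> pn pn' ne e; rewrite /run_len.
apply: (@uniq_leq_size _ [:: p; p']); first by rewrite /= inE ne.
move=> x; rewrite !inE mem_filter mem_iota /= add0n /wlen size_w.
by case/orP => /eqP ->; rewrite ?e eqxx.
Qed.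

Lemma run_len_gt0 p : p < n -> 0 < run_len w (rid w p).
Proof.
move=> pn; rewrite /run_len -has_predT; apply/hasP; exists p => //.
by rewrite mem_filter mem_iota /wlen size_w eqxx.
Qed.

Lemma not_run_end p : p < n -> ~~ is_run_end w p -> p.+1 < n /\ rid w p.+1 = rid w p.
Proof.
move=> pn; rewrite /is_run_end /wlen size_w negb_or => /andP[ne ns].
by rewrite ltn_neqAle ne pn ridS (negPf ns) addn0.
Qed.

Lemma closer_or_singleton p : p < n ->
  is_closer w p || is_singleton w p = is_run_end w p.
Proof.
move=> pn; rewrite /is_closer /is_singleton; have := run_len_gt0 pn.
case: (boolP (is_run_end w p)) => [_|ne] /=; first by case: (run_len w _) => [|[]].
have [pn' e] := not_run_end pn ne.
have : 1 < run_len w (rid w p) by apply: (@run_len_gt1 p p.+1); rewrite // neq_ltn ltnSn.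
by case: (run_len w _) => [|[]].
Qed.

Lemma singletonE p : p < n -> is_singleton w p = run_start w p && is_run_end w p.
Proof.
move=> pn; rewrite /is_singleton.
case: (boolP (is_run_end w p)) => [se|ne]; last first.
  have [pn' e] := not_run_end pn ne; rewrite andbF.
  have : 1 < run_len w (rid w p) by apply: (@run_len_gt1 p p.+1); rewrite // neq_ltn ltnSn.
  by case: (run_len w _) => [|[]].
case: (boolP (run_start w p)) => [ss|ns]; last first.
  case: p pn ns se => // p pn ns _.
  have e : rid w p.+1 = rid w p by rewrite ridS (negPf ns) addn0.
  have : 1 < run_len w (rid w p.+1).
    by apply: (@run_len_gt1 p.+1 p); rewrite ?(ltnW pn) // neq_ltn ltnSn orbT.
  by case: (run_len w _) => [|[]].
rewrite /run_len /run_pos (eq_in_filter (a2 := pred1 p)).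
  by rewrite filter_pred1_uniq ?iota_uniq // mem_iota /wlen size_w.
move=> p'; rewrite mem_iota /= add0n /wlen size_w => pn'.
case: (ltngtP p' p) => [lt|gt|->]; last by rewrite eqxx.
  apply/negbTE; rewrite neq_ltn; apply/orP; left.
  case: p pn ss se lt => // p pn ss _ lt; rewrite ridS ss addn1 ltnS.
  exact: rid_mono.
apply/negbTE; rewrite neq_ltn; apply/orP; right.
apply: leq_trans (rid_mono gt); rewrite ridS.
move: se; rewrite /is_run_end /wlen size_w => /orP[/eqP e|->]; last by rewrite addn1.
by move: pn'; rewrite -e ltnNge gt.
Qed.

Local Notation pos_one := (pos1 w).
Local Notation R := (inc_prefix 1 (drop pos_one.+1 w)).
Local Notation T := (inc_rest 1 (drop pos_one.+1 w)).
(** Position of d, the last and largest letter of the run of 1. *)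
Local Notation D := (pos_one + size R).

Lemma pos1_lt : pos_one < n.
Proof. by rewrite -size_w index_mem mem_w n_gt0. Qed.

Lemma wat_pos1 : w_[pos_one] = 1.
Proof. by rewrite /wat nth_index // mem_w n_gt0. Qed.

Lemma w_split : w = take pos_one w ++ (1 :: R) ++ T.
Proof.
rewrite /= inc_prefix_rest -[LHS](cat_take_drop pos_one) (drop_nth 0) ?size_w ?pos1_lt //.
by rewrite -/(wat w pos_one) wat_pos1.
Qed.

Lemma size_take_pos1 : size (take pos_one w) = pos_one.
Proof. by rewrite size_take size_w pos1_lt. Qed.

Lemma D_lt : D < n.
Proof.
by have := congr1 size w_split; rewrite size_w !size_cat size_take_pos1 /=; lia.
Qed.

Lemma wat_split p : w_[p] = nth 0 (take pos_one w ++ (1 :: R) ++ T) p.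
Proof. by rewrite -w_split. Qed.

Lemma wat_run1 k : k <= size R -> w_[pos_one + k] = nth 0 (1 :: R) k.
Proof.
move=> kR; rewrite wat_split nth_cat size_take_pos1.
by rewrite ltnNge leq_addr /= addKn -cat_cons nth_cat /= ltnS kR.
Qed.

Lemma wat_T k : w_[D.+1 + k] = nth 0 T k.
Proof.
rewrite wat_split catA nth_cat size_cat size_take_pos1 /=.
by rewrite addnS ltnNge leq_addr /= addKn.
Qed.

Lemma wat_D : w_[D] = last 1 R.
Proof. by rewrite wat_run1 // -last_nth. Qed.

Lemma start_pos1 : run_start w pos_one.
Proof.
rewrite /run_start; case e : pos_one => [|p] //=.
have := wat_pos1; rewrite e => ->.
have pn : p < n by apply: leq_ltn_trans pos1_lt; rewrite e.
have /andP[h _] := wat_bounds pn; rewrite ltn_neqAle h andbT eq_sym.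
apply/eqP => h1; have := wat_inj pn pos1_lt; rewrite h1 wat_pos1 => /(_ erefl) e'.
by move: e; rewrite e'; lia.
Qed.

Lemma rid_run1 k : k <= size R -> rid w (pos_one + k) = rid w pos_one.
Proof.
elim: k => [|k IH] kR; first by rewrite addn0.
rewrite addnS ridS IH; last exact: ltnW.
have /(pathP 0) /(_ k kR) := path_inc_prefix 1 (drop pos_one.+1 w).
rewrite -[nth 0 R k]/(nth 0 (1 :: R) k.+1) -!wat_run1 ?(ltnW kR) // addnS => lt.
by rewrite /run_start /= ltnNge (ltnW lt) addn0.
Qed.

Lemma rid_before p : p < pos_one -> rid w p < rid w pos_one.
Proof.
have := start_pos1; case: pos_one => // k ss pk; rewrite ridS ss addn1 ltnS.
exact: rid_mono.
Qed.

Lemma rid_after p : p < n -> D < p -> rid w pos_one < rid w p.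
Proof.
move=> pn Dp; apply: leq_trans (rid_mono Dp).
rewrite ridS rid_run1 // -addn1 leq_add2l /run_start /=.
have D1 : D.+1 < n by apply: leq_ltn_trans pn.
have /andP[le _] : (w_[D.+1] <= w_[D]) && true.
  by rewrite -[D.+1]addn0 wat_T nth0 wat_D head_inc_rest.
rewrite lt0b ltn_neqAle le andbT; apply/eqP => /(wat_inj D1 D_lt)/eqP.
by rewrite eqn_leq ltnn.
Qed.

Lemma rid_r1 p : p < n -> (rid w p == rid w pos_one) = (pos_one <= p <= D).
Proof.
move=> pn; case: (ltnP p pos_one) => [lt|le] /=; first by rewrite ltn_eqF ?rid_before.
case: leqP => [le'|gt]; last by rewrite gtn_eqF ?rid_after.
by rewrite -(subnKC le) rid_run1 ?eqxx // leq_subLR.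
Qed.

Lemma mem_run1 p : p < n -> (w_[p] \in 1 :: R) = (rid w p == rid w pos_one).
Proof.
move=> pn; rewrite rid_r1 //; apply/idP/idP => [/(nthP 0)[k kR]|/andP[le le']].
  rewrite -wat_run1 // => e; rewrite -(wat_inj _ pn e); last first.
    by apply: leq_ltn_trans D_lt; rewrite leq_add2l.
  by rewrite leq_addr leq_add2l.
have kR : p - pos_one <= size R by rewrite leq_subLR.
by rewrite -(subnKC le) wat_run1 // mem_nth.
Qed.

Lemma run_vals1 x : (x \in run_vals w (rid w pos_one)) = (x \in 1 :: R).
Proof.
apply/idP/idP => [/run_valsP[p [pn e ->]]|hx]; first by rewrite mem_run1 // e.
have xw : x \in w by rewrite w_split mem_cat mem_cat hx orbT.
have pn : index x w < n by rewrite -size_w index_mem.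
have e : w_[index x w] = x by rewrite /wat nth_index.
by rewrite -e mem_run_vals // -mem_run1 // e.
Qed.

Lemma le_last_run1 x : x \in 1 :: R -> x <= last 1 R.
Proof. exact: path_ltn_last (path_inc_prefix _ _). Qed.

Lemma dvalE : dval w = last 1 R.
Proof.
have leP s m : all (geq m) s -> foldr maxn 0 s <= m.
  by elim: s => //= x s IH /andP[xm /IH h]; rewrite geq_max xm.
have geP s x : x \in s -> x <= foldr maxn 0 s.
  elim: s => //= y s IH; rewrite inE leq_max => /orP[/eqP ->|/IH ->]; rewrite ?leqnn ?orbT //.
apply/eqP; rewrite eqn_leq leP /=; last first.
  by apply/allP => x; rewrite run_vals1 => /le_last_run1.
by apply: geP; rewrite run_vals1 mem_last.
Qed.

Lemma dposE : dpos w = D.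
Proof. by rewrite /dpos dvalE -wat_D index_wat // D_lt. Qed.

Lemma straddles_r1 p : p < n -> rid w p != rid w pos_one ->
  straddles w (rid w pos_one) w_[p] = (w_[p] < last 1 R).
Proof.
move=> pn np; have n1 : w_[p] != 1.
  by apply: contra np => /eqP e; rewrite -mem_run1 // e mem_head.
have -> : straddles w (rid w pos_one) w_[p] =
    has (fun x => w_[p] < x) (run_vals w (rid w pos_one)).
  rewrite /straddles andb_idl // => _; apply/hasP; exists 1.
    by rewrite run_vals1 mem_head.
  by have /andP[h _] := wat_bounds pn; rewrite ltn_neqAle eq_sym n1.
apply/hasP/idP => [[x]|h]; last by exists (last 1 R); rewrite // run_vals1 mem_last.
by rewrite run_vals1 => /le_last_run1 h h'; apply: leq_trans h' h.
Qed.

Lemma crossings_before p (v := w_[p]) : p < n ->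
  crossings v v (N :: take p w) = count (cross v) (iota 0 p).
Proof.
move=> pn /=; rewrite ltnn /= add0n crossings_nth size_take size_w pn.
have vN : v < N by have /andP[] := wat_bounds pn.
apply: eq_in_count => -[|j]; rewrite mem_iota /= add0n => jp.
  by rewrite ltnNge ltnW.
by rewrite /cross /= /wat !nth_take // ltnW.
Qed.

Lemma crossings_after p (v := w_[p]) : p < n ->
  crossings v v (drop p.+1 w) = count (cross v) (iota p.+1 (n - p.+1)).
Proof.
move=> pn; rewrite crossings_nth size_drop size_w.
have -> : iota p.+1 (n - p.+1) = map (addn p.+1) (iota 0 (n - p.+1)).
  by rewrite -iotaDl addn0.
rewrite count_map.
apply: eq_count => -[|j].
  by rewrite /cross /preim /= addn0 /= ltnn.
by rewrite /cross /preim /= addnS /= !nth_drop addnS.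
Qed.

(** A crossing before [p] never lies in the run of [p], whose earlier letters are below [v];
    positions from [p] on lie in runs not to the left. *)
Lemma count_left p (v := w_[p]) : p < n ->
  count (fun r => straddles w r v) (iota 0 (rid w p)) = crossings v v (N :: take p w).
Proof.
move=> pn; rewrite crossings_before // straddle_count ?iota_uniq //; last first.
  by rewrite mem_iota /= add0n ltnn.
rewrite -(subnKC (ltnW pn)) iotaD count_cat -[RHS]addn0 add0n; congr (_ + _).
  apply: eq_in_count => k; rewrite !mem_iota /= !add0n => kp; rewrite andb_idr // => ck.
  have kn := ltn_trans kp pn; have [j _ [_ _ vk]] := crossP ck kn.
  rewrite ltn_neqAle rid_mono ?(ltnW kp) // andbT; apply/eqP => e.
  by have := wat_run kp pn e; rewrite ltnNge ltnW.
apply/eqP; rewrite -leqn0 leqNgt -has_count; apply/hasPn => k.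
rewrite !mem_iota /= => /andP[pk _]; rewrite negb_and -leqNgt.
by rewrite rid_mono ?orbT.
Qed.

Lemma count_right p (v := w_[p]) : p < n ->
  count (fun r => straddles w r v) (iota (rid w p).+1 (nrun w - (rid w p).+1))
  = crossings v v (drop p.+1 w).
Proof.
move=> pn; rewrite crossings_after // straddle_count ?iota_uniq //; last first.
  by rewrite mem_iota ltnn.
rewrite -[in LHS](subnKC pn) iotaD count_cat -[RHS]add0n add0n; congr (_ + _).
  apply/eqP; rewrite -leqn0 leqNgt -has_count; apply/hasPn => k.
  rewrite !mem_iota /= add0n ltnS => kp.
  by rewrite [rid w p < _]ltnNge (rid_mono kp) andbF.
apply: eq_in_count => k; rewrite !mem_iota => /andP[pk]; rewrite (subnKC pn) => kn.
rewrite andb_idr // => ck; rewrite (subnKC (rid_lt_nrun pn)) rid_lt_nrun // andbT.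
have [j ek [rk jv _]] := crossP ck kn.
rewrite ltn_neqAle rid_mono ?(ltnW pk) // andbT; apply/eqP => e.
move: pk; rewrite ek ltnS leq_eqVlt => /orP[/eqP pj|pj].
  by move: jv; rewrite -pj ltnn.
have jn : j < n by apply: leq_ltn_trans kn; rewrite ek.
by have := wat_run pj jn; rewrite -rk => /(_ e); rewrite ltnNge ltnW.
Qed.

(** The flag [far] says that the run of 1 lies strictly to the left. Since it contains 1, it
    straddles [v] as soon as its maximum exceeds [v]. *)
Lemma lsg_atE p (v := w_[p]) (op := v < last 1 R)
    (far := (pos_one < p) && (rid w p != rid w pos_one)) : p < n ->
  lsg_at w p = if is_run_end w p
    then crossings v v (N :: take p w) - (far && op)
    else crossings v v (N :: take p w) + (far && ~~ op).
Proof.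
move=> pn; have farE : (r1 w \in iota 0 (rid w p)) = far.
  rewrite mem_iota /= add0n /far /r1; case: (ltnP pos_one p) => [lt|le] /=.
    by rewrite ltn_neqAle rid_mono ?(ltnW lt) // andbT eq_sym.
  by rewrite ltnNge rid_mono.
have opE : far -> straddles w (r1 w) v = op.
  by case/andP => _ h; rewrite straddles_r1.
rewrite -count_left // /lsg_at /counts closer_or_singleton //.
case: (is_run_end w p); rewrite ?count_neq_and ?count_eq_or ?iota_uniq // farE;
  by case: far opE {farE} => //= ->.
Qed.

Lemma rsg_atE p (v := w_[p]) (op := v < last 1 R)
    (far := (p <= pos_one) && (rid w p != rid w pos_one)) : p < n ->
  rsg_at w p = if is_run_end w p
    then crossings v v (drop p.+1 w) - (far && op)
    else crossings v v (drop p.+1 w) + (far && ~~ op).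
Proof.
move=> pn; have farE : (r1 w \in iota (rid w p).+1 (nrun w - (rid w p).+1)) = far.
  rewrite mem_iota (subnKC (rid_lt_nrun pn)) rid_lt_nrun ?pos1_lt // andbT /far /r1.
  case: (leqP p pos_one) => [le|lt] /=; first by rewrite ltn_neqAle rid_mono // andbT.
  by rewrite ltnNge rid_mono // ltnW.
have opE : far -> straddles w (r1 w) v = op.
  by case/andP => _ h; rewrite straddles_r1.
rewrite -count_right // /rsg_at /counts closer_or_singleton //.
case: (is_run_end w p); rewrite ?count_neq_and ?count_eq_or ?iota_uniq // farE;
  by case: far opE {farE} => //= ->.
Qed.

Definition low_at p := (w_[p] <= last 1 R) && has_low w_[p] N T.

Lemma wtE p : p < n ->
  wt N w_[p] (N :: w) =
    (run_start w p && (w_[p] != 1)) + 2 * lsg_at w p + rsg_at w p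
    + (if low_at p then 2 - (p <= pos_one) else 0).
Proof.
move=> pn; have /andP[v0 vn] := wat_bounds pn.
have vN : (N == w_[p]) = false by rewrite gtn_eqF.
have oneN : (N == 1) = false by rewrite eqSS gtn_eqF.
rewrite /wt /before /after /= vN oneN index_wat // -/(pos1 w) /=.
have -> : (w_[p] < last N (take p w)) = run_start w p.
  rewrite /run_start; case: p pn {v0 vn vN} => [|p] pn /=.
    by rewrite take0 /= ltnS; have /andP[] := wat_bounds pn.
  rewrite (take_nth 0) ?last_rcons // size_w ltnW //.
have -> : (head 0 (drop p.+1 w) < w_[p]) = is_run_end w p.
  by rewrite run_endE // -nth0 nth_drop addn0.
have -> : (1 \in N :: take p w) = (pos_one < p).
  by rewrite inE eq_sym oneN in_take // mem_w n_gt0.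
have -> : (w_[p] == 1) || (w_[p] \in R) = (rid w p == rid w pos_one).
  by rewrite -mem_run1 // inE.
rewrite lsg_atE // rsg_atE // /wgt /low_at /= -!leqNgt !andbA.
by case: (is_run_end w p).
Qed.

Lemma size_T : D.+1 + size T = n.
Proof.
have := congr1 size w_split; rewrite size_w !size_cat size_take_pos1 /=.
by rewrite addSn addnS addnA.
Qed.

Lemma mem_cand p :
  (p \in cand w) =
  [&& D < p, p < n, all (fun p' => w_[p] < w_[p']) (iota D.+1 (p - D.+1)),
      run_start w p & is_run_end w p].
Proof.
rewrite mem_filter /right_pos /is_ltr_min_right dposE mem_iota /wlen size_w.
rewrite (subnKC D_lt); case: (ltnP p n) => pn; last by rewrite !andbF.
by rewrite singletonE //; case: (D < p); rewrite ?andbF //= andbT.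
Qed.

(** A left-to-right minimum of [T] always starts a run, as the preceding letter is larger, even for
    the first letter of [T]; so it is a singleton run exactly when a smaller letter or the end
    follows. *)
Lemma has_low_cand v : v <= n -> has_low v N T = has (fun p => w_[p] < v) (cand w).
Proof.
move=> vn; have minE : minn v N = v by apply/minn_idPl; apply: leqW.
apply/has_lowP/hasP.
  case=> k [kT]; rewrite minE => kv hk kl; exists (D.+1 + k); last by rewrite wat_T.
  have kn : D.+1 + k < n by rewrite -size_T ltn_add2l.
  rewrite mem_cand addSn ltnS leq_addr -addSn kn /= addKn run_endE //.
  rewrite -(addnS D.+1 k) !wat_T kl andbT; apply/andP; split.
    apply/allP => p'; rewrite mem_iota => /andP[Dp' p'k].
    have e := subnKC Dp'; rewrite -e wat_T; apply: hk.
    by rewrite -(ltn_add2l D.+1) e.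
  rewrite /run_start wat_T; case: k {kv kl} kT hk kn => [|k] kT hk kn.
    rewrite addn0 /= ltn_neqAle nth0 wat_D head_inc_rest andbT.
    apply/eqP; rewrite -nth0 -wat_T -wat_D addn0 => /(wat_inj _ D_lt).
    by rewrite addn0 in kn => /(_ kn)/eqP; rewrite eqn_leq ltnn.
  by rewrite addnS /= wat_T hk.
case=> p; rewrite mem_cand => /and5P[Dp pn hp ss se] pv.
have e := subnKC Dp; exists (p - D.+1).
rewrite minE -!wat_T addnS e; split=> //.
- by rewrite -(ltn_add2l D.+1) e size_T.
- move=> k' hk'; rewrite -wat_T; apply: (allP hp).
  by rewrite mem_iota leq_addr ltn_add2l.
by rewrite -run_endE.
Qed.

(** Left-to-right minima decrease, so the rightmost candidate c is the least one. *)
Lemma cand_last p : p \in cand w ->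
  last 0 (cand w) \in cand w /\ w_[last 0 (cand w)] <= w_[p].
Proof.
have : sorted ltn (cand w).
  by apply: sorted_filter; [exact: ltn_trans | exact: iota_ltn_sorted].
have : last 0 (cand w) \in cand w \/ cand w = [::].
  by case: (cand w) => [|x s]; [right | left; rewrite /= mem_last].
case=> [hl|-> //] hs hp; split=> //.
have : p <= last 0 (cand w).
  by case: (cand w) hs hp => //= x s; apply: path_ltn_last.
rewrite leq_eqVlt => /orP[/eqP -> //|lt].
move: hl hp; rewrite !mem_cand => /and5P[Dq qn hq _ _] /and5P[Dp _ _ _ _].
apply/ltnW/(allP hq); by rewrite mem_iota Dp (subnKC Dq).
Qed.

(** Each of the d - c letters with c < v <= d gets 2, less 1 if it stands left of 1. The strict
    bounds in [nleft] agree with this, since 1 does not exceed c and d is not left of 1. *)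
Lemma nuE : nu w = \sum_(p <- iota 0 n) (if low_at p then 2 - (p <= pos_one) else 0).
Proof.
rewrite /nu; case E: (cand w) => [|x s].
  rewrite big_seq big1 // => p; rewrite mem_iota /= add0n => pn; rewrite /low_at.
  have /andP[_ vn] := wat_bounds pn.
  by rewrite has_low_cand // E andbF.
rewrite -E; have xc : x \in cand w by rewrite E mem_head.
have [lc _] := cand_last xc.
set c := w_[last 0 _]; set d := dval w.
have dn : d <= n.
  by rewrite /d dvalE -wat_D; have /andP[] := wat_bounds D_lt.
have c0 : 0 < c.
  by move: lc; rewrite mem_cand => /and5P[_ ln _ _ _]; have /andP[] := wat_bounds ln.
have lowE p : p < n -> low_at p = (c < w_[p] <= d).
  move=> pn; have /andP[_ vn] := wat_bounds pn.
  rewrite /low_at has_low_cand // /d dvalE andbC; congr (_ && _).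
  apply/hasP/idP => [[p' hp' lt]|lt]; last by exists (last 0 (cand w)).
  by have [_ h] := cand_last hp'; apply: leq_ltn_trans lt.
have lt_pn := pos1_lt.
have total : \sum_(p <- iota 0 n) (c < w_[p] <= d) = d - c.
  rewrite -(big_map (wat w) xpredT (fun v => nat_of_bool (c < v <= d))).
  have -> : [seq wat w p | p <- iota 0 n] = w by rewrite -size_w; apply: mkseq_nth.
  rewrite (perm_big _ w_perm) /= -big_mkcond sum1_count count_itv.
  by rewrite (minn_idPr dn).
have left : count (fun x => (c < x) && (x < d)) (take pos_one w)
    = \sum_(p <- iota 0 n | p <= pos_one) (c < w_[p] <= d).
  have -> : take pos_one w = [seq wat w p | p <- iota 0 pos_one].
    by rewrite map_nth_iota0 // size_w ltnW.
  rewrite count_map -sum1_count big_mkcond -[in RHS](subnKC lt_pn) iotaD big_cat.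
  rewrite [X in _ = _ + X]big1_seq ?addn0; last first.
    by move=> p /andP[le]; rewrite mem_iota => /andP[lt _]; exfalso; lia.
  rewrite -[pos_one.+1]addn1 iotaD big_cat /= big_cons big_nil !add0n leqnn wat_pos1.
  rewrite [c < 1]ltnNge c0 /= !addn0 big_seq [RHS]big_seq_cond.
  have <- : \sum_(p <- iota 0 pos_one | p \in iota 0 pos_one) nat_of_bool (c < w_[p] <= d)
     = \sum_(p <- iota 0 pos_one | (p \in iota 0 pos_one) && (p <= pos_one)) (c < w_[p] <= d).
    apply: eq_bigl => p; rewrite andb_idr // mem_iota add0n; exact: ltnW.
  apply: eq_bigr => p; rewrite mem_iota /= add0n => pP.
  rewrite [w_[p] <= d]leq_eqVlt; case: eqP => [e|_]; last by case: (_ && _).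
  have pn := ltn_trans pP lt_pn; move: e; rewrite /d dvalE -wat_D.
  by move/(wat_inj pn D_lt) => e; move: pP; rewrite e ltnNge leq_addr.
apply/eqP; rewrite left -(eqn_add2r (\sum_(p <- iota 0 n | p <= pos_one) (c < w_[p] <= d))).
(* The truncated subtraction in [nu] is exact: the letters counted on the left are among the d - c
   letters. *)
rewrite subnK; last first.
  by rewrite -total big_distrr /= [X in X <= _]big_mkcond leq_sum // => p _; case: ifP; lia.
rewrite -total big_distrr /= [X in _ == _ + X]big_mkcond -big_split /=.
apply/eqP/eq_big_seq => p; rewrite mem_iota /= add0n => pn.
by rewrite lowE //; case: (c < w_[p] <= d); case: (p <= pos_one).
Qed.

(** Each run is charged to its first letter; 1 always starts a run, and omitting it accounts for the
    predecessor. *)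
Lemma nrunE : (nrun w).-1 = \sum_(p <- iota 0 n) (run_start w p && (w_[p] != 1)).
Proof.
rewrite /nrun /wlen size_w -sum1_count big_mkcond (bigD1_seq pos_one) ?iota_uniq //=; last first.
  by rewrite mem_iota /= add0n pos1_lt.
rewrite start_pos1 (bigD1_seq pos_one) ?iota_uniq //=; last first.
  by rewrite mem_iota /= add0n pos1_lt.
rewrite wat_pos1 eqxx andbF !add0n big_seq_cond [RHS]big_seq_cond.
apply: eq_bigr => p; rewrite mem_iota /= add0n => /andP[pn ne].
have -> : w_[p] != 1; last by case: (run_start w p).
by apply: contra ne => /eqP e; rewrite (wat_inj pn pos1_lt) // e wat_pos1.
Qed.

Lemma statE : stat w = \sum_(1 <= v < N) wt N v (N :: w).
Proof.
rewrite /stat nuE nrunE /lsg /rsg !sumnE !big_map /wlen size_w big_distrr /=.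
rewrite -!big_split /= /index_iota subn1 -(perm_big _ w_perm) /=.
have wE : [seq wat w p | p <- iota 0 n] = w by rewrite -size_w; apply: mkseq_nth.
rewrite -[in RHS]wE big_map; apply: eq_big_seq => p.
by rewrite mem_iota /= add0n => pn; rewrite wE wtE.
Qed.

End WordStat.

(** * Conclusion *)

Local Open Scope ring_scope.

Lemma uniq_subset_perm (A : eqType) (s1 s2 : seq A) : uniq s1 -> uniq s2 ->
  {subset s1 <= s2} -> (size s2 <= size s1)%N -> perm_eq s1 s2.
Proof.
move=> u1 u2 s12 le; apply: uniq_perm => //.
exact: (uniq_min_size u1 s12 le).2.
Qed.

Lemma perm_word_perm n (s : 'S_n) : perm_eq (perm_word s) (iota 1 n).
Proof.
apply: uniq_subset_perm; rewrite ?iota_uniq ?size_map ?size_iota ?size_enum_ord //.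
  by rewrite map_inj_uniq ?enum_uniq // => i j [] /val_inj/perm_inj.
by move=> x /mapP[i _ ->]; rewrite mem_iota add1n !ltnS ltn_ord.
by rewrite -enumT size_enum_ord.
Qed.

Lemma perm_word_inj n : injective (@perm_word n).
Proof.
move=> s t /eq_in_map e; apply/permP => i; apply/val_inj.
by have [] := e i (mem_enum _ i).
Qed.

Lemma sum_perm_word (V : nmodType) n (f : seq nat -> V) :
  \sum_(s : 'S_n) f (perm_word s) = \sum_(w <- words n) f w.
Proof.
rewrite -(big_map (@perm_word n) xpredT f); apply: perm_big.
apply: uniq_subset_perm.
- by rewrite map_inj_uniq ?index_enum_uniq //; apply: perm_word_inj.
- exact: permutations_uniq.
- by move=> w /mapP[s _ ->]; rewrite mem_words perm_word_perm.
rewrite size_permutations ?iota_uniq // size_iota size_map.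
by rewrite -(card_Sn n) cardE enumT.
Qed.

Lemma fiber_total (K : comNzRingType) (q : K) n : (0 < n)%N ->
  fiber q n 0 [:: n.+1] = qf q n.
Proof.
case: n => // n _; set N := n.+2.
have v0 : valid n.+1 0 [:: N] by split.
(* Only the leading gap exists, so 1 is an opener or a singleton; the two outcomes start the two
   phases with p = r = 0. *)
have succE : succ N 1 [:: N] = [:: [:: N; 1%N; N]; [:: N; 1%N]].
  by rewrite /succ /gaps /types /ins /= eqxx.
rewrite fiber_rec // succE !big_cons big_nil addr0.
have wt0 s : s \in succ N 1 [:: N] -> wt N 1 s = 0%N.
  by rewrite succE !inE => /orP[] /eqP -> ; rewrite /wt /before /after /wgt /=.
rewrite !wt0 ?succE ?inE ?eqxx ?orbT // !expr0 !mul1r.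
have openE : fiber q n.+1 1 [:: N; 1%N; N] = fsum q n 0 - bsum q n 0 0.
  apply: (@fiberA1 _ _ _ n _ _ 0 0); rewrite ?add1n //.
  by exists [:: N], [::], [::]; split=> //=; rewrite eqxx.
have closedE : fiber q n.+1 1 [:: N; 1%N] = bsum q n 0 0.
  apply: (@fiberB _ _ _ n _ _ 0 0); rewrite ?add1n //.
  by exists [:: N], [::], [::]; split=> //=; rewrite eqxx.
by rewrite openE closedE subrK fsum_last.
Qed.

Theorem theorem4 (n : nat) (hn : (1 <= n)%N) :
  \sum_(s : 'S_n) 'X^(stat (perm_word s)) = qfact n.
Proof.
rewrite (sum_perm_word n (fun w => 'X^(stat w))) -[RHS]/(qf 'X n) -fiber_total //.
rewrite /fiber big_seq [RHS]big_seq_cond; apply: eq_big => w.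
  case hw : (w \in words n) => //=; symmetry.
  (* All letters exceed 0, so at level 0 the leading gap absorbs the whole word and the fiber
     consists of all words. *)
  suff -> : coll n.+1 0 n.+1 w = [::] by rewrite eqxx.
  have: all (ltn 0) w.
    by move: hw; rewrite mem_words => /perm_all ->; apply/allP => x; rewrite mem_iota => /andP[].
  elim: w n.+1 {2}n.+1 (ltn0Sn n) {hw} => //= x w IH N a a0 /andP[x0 hw].
  by rewrite x0 a0 IH.
by rewrite mem_words => pw; rewrite (statE hn pw).
Qed.
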